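(* Let $M$ be a Riemannian manifold. Fix $p>1$, $\chi\in(-1,p-1]$, $\bar\eta_0\ge0$, and let $f\in C(\mathbb R)$ satisfy $$f>0\ \text{ on }(\bar\eta_0,\infty),\qquad F(t)^{\frac{\chi}{\chi+1}}\le c_Ff(t)\ \text{ on }(\bar\eta_0,\infty),\ \text{ for some constant }c_F>0,$$ where $F(t)=\int_{\bar\eta_0}^tf(s)\,ds$. Let $u\in C^1(M)$ be a non-constant solution of $\Delta_pu\ge f(u)|\nabla u|^{p-1-\chi}$ on $M$. If 1. $l^{-1}\Delta_p$ satisfies the strong maximum principle at infinity with $l(t)=t^{p-1-\chi}$, and 2. the Keller–Osserman condition $F(t)^{-\frac{1}{\chi+1}}\in L^1(\infty)$ holds, then $$u^*=\sup_Mu<\infty\quad\text{and}\quad f(u^* )\le0.$$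
   Context: Manifolds are smooth and connected; $M$ is non-compact of dimension $m\ge2$. $\Delta_pu=\operatorname{div}(|\nabla u|^{p-2}\nabla u)$ (the vector field is $0$ where $\nabla u=0$); for $\Omega$ open, $u\in C^1(\Omega)$ solves $\Delta_pu\ge g$ on $\Omega$ if $-\int_\Omega|\nabla u|^{p-2}\langle\nabla u,\nabla\psi\rangle\ge\int_\Omega g\,\psi$ for every $0\le\psi\in C_c^\infty(\Omega)$. $L^1(\infty)$ denotes integrability in a neighbourhood of $+\infty$. $l^{-1}\Delta_p$ satisfies the strong maximum principle at infinity if for every non-constant $w\in C^1(M)$ with $w^*=\sup_Mw<\infty$ and every $\eta<w^*$, $\varepsilon>0$, the set $\Omega_{\eta,\varepsilon}=\{x\in M:w(x)>\eta,\ |\nabla w(x)|<\varepsilon\}$ is non-empty and the following holds: if $k\in\mathbb R$ and $w$ solves $\Delta_pw\ge k\,l(|\nabla w|)$ on $\Omega_{\eta,\varepsilon}$, then $k\le0$. *)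

(* Defs.v *)
From HB Require Import structures.
From mathcomp Require Import all_boot all_order all_algebra.
From mathcomp Require Import all_classical all_reals all_analysis.

Set Implicit Arguments.
Unset Strict Implicit.
Unset Printing Implicit Defensive.
Import Order.TTheory GRing.Theory Num.Theory.
Import numFieldNormedType.Exports.
Local Open Scope classical_set_scope.
Local Open Scope ring_scope.

(* Points and tangent vectors of R^m are row vectors; the library's jacobian
   acts on them from the right: 'd f y v = v *m jacobian f y. *)

Section Ck.
Context {R : realType} {m : nat} {V : normedModType R}.

(* For k = j.+1: Df exists on U and its components, the partial derivatives,
   are of class C^j on U. Meant for open U. *)
Fixpoint Ck_on (k : nat) (U : set 'rV[R]_m) (f : 'rV[R]_m -> V) : Prop :=
  match k with
  | 0%N => {in U, continuous f}
  | j.+1 => (forall y, U y -> differentiable f y) /\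
            (forall a : 'I_m, Ck_on j U ('D_(delta_mx 0 a) f))
  end.

Definition smooth_on (U : set 'rV[R]_m) (f : 'rV[R]_m -> V) : Prop :=
  forall k, Ck_on k U f.

End Ck.

(* chart_at x selects one of the charts around x; its existence says that the
   charts cover M. The maps chart_inv i are total, but only their restriction
   to chart_im i matters. *)
Record smooth_atlas (R : realType) (m : nat) (M : topologicalType) := SmoothAtlas {
  chart_ix : Type;
  chart_dom : chart_ix -> set M;
  chart : chart_ix -> M -> 'rV[R]_m;
  chart_inv : chart_ix -> 'rV[R]_m -> M;
  chart_at : M -> chart_ix;
  chart_im := fun i => chart i @` chart_dom i;
  chart_at_dom : forall x, chart_dom (chart_at x) x;
  chart_dom_open : forall i, open (chart_dom i);
  chart_im_open : forall i, open (chart_im i);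
  chartK : forall i, {in chart_dom i, cancel (chart i) (chart_inv i)};
  chart_continuous : forall i, {in chart_dom i, continuous (chart i)};
  chart_inv_continuous : forall i, {in chart_im i, continuous (chart_inv i)};
  chart_trans_smooth : forall i j,
    smooth_on (chart i @` (chart_dom i `&` chart_dom j))
              (chart j \o chart_inv i)
}.

(* gram i y is the matrix of the metric in the coordinates of the chart i, at
   the point of coordinates y. *)
Record riemannian_metric (R : realType) (m : nat) (M : topologicalType)
    (A : smooth_atlas R m M) := RiemannianMetric {
  gram : chart_ix A -> 'rV[R]_m -> 'M[R]_m;
  gram_smooth : forall i, smooth_on (chart_im i) (gram i);
  gram_sym : forall i y, chart_im i y -> (gram i y)^T = gram i y;
  gram_pos : forall i y (v : 'rV[R]_m), chart_im i y -> v != 0 ->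
    0 < (v *m gram i y *m v^T) 0 0;
  gram_trans : forall i j x, chart_dom i x -> chart_dom j x ->
    let J := jacobian (chart j \o chart_inv i) (chart i x) in
    gram i (chart i x) = J *m gram j (chart j x) *m J^T
}.

(* Lebesgue integral over R^n of a nonnegative Borel function, as an iterated
   integral (Tonelli). *)
Fixpoint lebesgue_integral_rV (R : realType) (n : nat) :
    ('rV[R]_n -> \bar R) -> \bar R :=
  match n with
  | 0%N => fun h => h 0
  | k.+1 => fun h =>
      (\int[@lebesgue_measure R]_(t in setT)
         lebesgue_integral_rV
           (fun v : 'rV[R]_k => h (row_mx (t%:M : 'rV[R]_1) v : 'rV[R]_(1 + k))))%E
  end.

Notation borel M := (g_sigma_algebraType (@open M)).

Section Riemannian.
Context {R : realType} {m : nat} {M : ptopologicalType}.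
Variables (A : smooth_atlas R m M) (g : riemannian_metric A).

(* The Riemannian measure is the only Borel measure equal to
   sqrt (det g) dx in each chart. *)
Definition is_riemannian_measure (vol : {measure set (borel M) -> \bar R}) : Prop :=
  forall i (B : set (borel M)), measurable B -> B `<=` chart_dom (s := A) i ->
    vol B = lebesgue_integral_rV (fun y =>
      (\1_(chart (s := A) i @` B) y * Num.sqrt (\det (gram g i y)))%:E).

Definition Ck_mfd (k : nat) (u : M -> R) : Prop :=
  forall i : chart_ix A, Ck_on k (chart_im i) ((u \o chart_inv i) : 'rV[R]_m -> R^o).

Definition smooth_mfd (u : M -> R) : Prop := forall k, Ck_mfd k u.

(* Tangent vectors at x are given by their coordinates in chart_at x. *)
Definition gram_at (x : M) : 'M[R]_m :=
  gram g (chart_at A x) (chart (chart_at A x) x).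

Definition inner (x : M) (v w : 'rV[R]_m) : R := (v *m gram_at x *m w^T) 0 0.

Definition tnorm (x : M) (v : 'rV[R]_m) : R := Num.sqrt (inner x v v).

Definition grad (u : M -> R) (x : M) : 'rV[R]_m :=
  (\row_(a < m) 'D_(delta_mx 0 a)
     ((u \o chart_inv (chart_at A x)) : 'rV[R]_m -> R^o) (chart (chart_at A x) x))
  *m invmx (gram_at x).

Definition grad_norm (u : M -> R) (x : M) : R := tnorm x (grad u x).

(* Vanishes where the gradient does, whatever the value of 0 `^ (p - 2). *)
Definition p_field (p : R) (u : M -> R) (x : M) : 'rV[R]_m :=
  (grad_norm u x `^ (p - 2)) *: grad u x.

(* Elements of C_c^oo(W) are extended by 0 to M. *)
Definition test_function (W : set M) (psi : M -> R) : Prop :=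
  [/\ smooth_mfd psi, compact (closure [set x | psi x != 0]) &
      closure [set x | psi x != 0] `<=` W].

Variable vol : {measure set (borel M) -> \bar R}.

(* Delta_p u >= h on W, in the weak sense. *)
Definition plaplacian_ge (p : R) (W : set M) (u h : M -> R) : Prop :=
  forall psi : M -> R, test_function W psi -> (forall x, 0 <= psi x) ->
    \int[vol]_(x in W) (h x * psi x)
      <= - \int[vol]_(x in W) inner x (p_field p u x) (grad psi x).

Definition nonconstant (u : M -> R) : Prop := ~ (exists c, forall x, u x = c).

Definition superlevel_small_grad (w : M -> R) (eta eps : R) : set M :=
  [set x | eta < w x /\ grad_norm w x < eps].

Definition strong_max_principle_at_infinity (p : R) (l : R -> R) : Prop :=
  forall w : M -> R, Ck_mfd 1 w -> nonconstant w -> has_ubound (range w) ->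
  forall eta eps : R, eta < sup (range w) -> 0 < eps ->
    superlevel_small_grad w eta eps !=set0 /\
    (forall k : R,
       plaplacian_ge p (superlevel_small_grad w eta eps) w
                     (fun x => k * l (grad_norm w x)) ->
       k <= 0).

End Riemannian.

(* Equal to 0 for t < eta0; only the values at t > eta0 are used. *)
Definition primitive (R : realType) (f : R -> R) (eta0 t : R) : R :=
  \int[@lebesgue_measure R]_(s in `[eta0, t]) f s.

Definition keller_osserman (R : realType) (f : R -> R) (eta0 chi : R) : Prop :=
  exists2 a : R, eta0 < a &
    (@lebesgue_measure R).-integrable `[a, +oo[
      (fun t => (primitive f eta0 t `^ (- (chi + 1)^-1))%:E).

(* Main.v *)
Require Import Defs.
From HB Require Import structures.
From mathcomp Require Import all_boot all_order all_algebra.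
From mathcomp Require Import all_classical all_reals all_analysis.
From mathcomp Require Import measurable_realfun ring lra.

Set Implicit Arguments.
Unset Strict Implicit.
Unset Printing Implicit Defensive.
Import Order.TTheory GRing.Theory Num.Theory.
Import numFieldNormedType.Exports.
Local Open Scope classical_set_scope.
Local Open Scope ring_scope.

(** If [u] is unbounded, compose it with [phi] such that
    [phi' = F ^ (- 1 / (chi + 1))] near infinity. By Keller-Osserman,
    [w = phi o u] is bounded, and
    [Delta_p w >= f(u) F(u) ^ (- chi / (chi + 1)) l(|dw|) (1 - C |dw| ^ (chi + 1))],
    which on [{w > phi a, |dw| < eps}] is at least [l(|dw|) / (2 cF)]: this
    contradicts the strong maximum principle. Once [u] is bounded, the
    principle applied to [u] itself excludes [f(u^* ) > 0].

    The weak inequality for [w] is that for [u] tested against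
    [phi'(u) ^ (p - 1) psi], which is only C^1. So the inequality has to be
    extended to C^1 test functions [v]: cover the support of [v] by finitely
    many coordinate simplices carrying smooth bumps [rho_z], write
    [v = sum_z rho_z q] with [q = v / sum_z rho_z], and approximate [q] in C^1
    on each simplex by its Bernstein polynomials, which are nonnegative. *)

(** The exponent [- 1 / (chi + 1)] is the one for which both terms of [Delta_p w], the one inherited
    from [f(u)] and the one produced by [phi''], carry the same power of [F(u)] once [|du|] is
    written in terms of [|dw|]. The assumption relating [F] and [f] says exactly that the common
    factor [f(u) F(u) ^ (- chi / (chi + 1))] is at least [1 / cF]; the constant [C] is
    [(p - 1) / (chi + 1)]. As [u] is only C^1, [phi''] enters through the gradient of the test
    function. Approximating that function must keep the sign, since the weak inequality is
    one-sided, and must control first derivatives, since [|du| ^ (p - 2) du] is paired with the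
    gradient. Bernstein polynomials do both and are smooth, but approximate only on the simplex. The
    factor [rho_z], flat at the boundary of the simplex, makes the product extend by 0 to a smooth
    function on [M], and confines the error to a compact set, of finite volume, on which [|du|] and
    the right-hand side are bounded. *)

Lemma near_eq_differentiable {R : numFieldType} (V W : normedModType R)
    (f g : V -> W) (x : V) :
  (\forall y \near x, f y = g y) -> differentiable f x -> differentiable g x.
Proof.
move=> fg df; rewrite (_ : g = f + (g - f)); last first.
  by apply/funext => y /=; rewrite addrC subrK.
apply: differentiableD => //.
have k0 : \forall y \near x, (g - f) y = 0.
  near=> y; rewrite -[LHS]/(g y - f y) (_ : f y = g y) ?subrr//.
  by near: y.
move: (g - f) k0 => k k0.
have kx : k x = 0 by apply: (nbhs_singleton k0).
have ck : continuous (0 : V -> W) by move=> z; exact: cvg_cst.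
have ke : k \o shift x = cst (k x) + 0 +o_ 0 id.
  rewrite kx; apply/eqaddoP => _/posnumP[e].
  near=> z; rewrite /= -[X in `|X|]/(k (z + x) - (0 + 0)) addr0 subr0.
  rewrite (_ : k (z + x) = 0) ?normr0 ?mulr_ge0//.
  near: z; have := k0; rewrite (near_shift 0) subr0.
  by apply: filterS => z /=.
by apply/diff_locallyP; rewrite (@diff_unique _ _ _ k (\0 : V -> W)).
Unshelve. all: by end_near. Qed.

(** * Calculus of C^k functions *)

Section Ck_calculus.
Context {R : realType} {m : nat}.
Local Notation E := 'rV[R]_m.
Local Notation e_ a := (delta_mx 0 a : 'rV[R]_m).

Lemma Ck_on0P (V : normedModType R) (U : set E) (f : E -> V) :
  Ck_on 0 U f <-> forall y, U y -> {for y, continuous f}.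
Proof.
by split=> H y Uy; apply: H; move: Uy; rewrite inE.
Qed.

Lemma Ck_on_subset (V : normedModType R) k (U W : set E) (f : E -> V) :
  W `<=` U -> Ck_on k U f -> Ck_on k W f.
Proof.
move=> WU; elim: k f => [|k IH] f.
  by rewrite !Ck_on0P => H y /WU; exact: H.
move=> [df Hf]; split=> [y /WU|a]; first exact: df.
by apply: IH; exact: Hf.
Qed.

(** [Ck_on] evaluates derivatives of the total function [f] at single points, so at each point it is
    inherited from any set around that point. Regularity on [M] is glued this way from pieces. *)
Lemma Ck_on_local (V : normedModType R) k (U : set E) (f : E -> V) :
  (forall y, U y -> exists W, W y /\ Ck_on k W f) -> Ck_on k U f.
Proof.
elim: k f => [|k IH] f H.
  by apply/Ck_on0P => y /H[W [Wy /Ck_on0P]]; apply.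
split=> [y /H[W [Wy [dW _]]]|a]; first exact: dW.
by apply: IH => y /H[W [Wy [_ Hf]]]; exists W; split=> //; exact: Hf.
Qed.

Lemma Ck_on_ext (V : normedModType R) k (U : set E) (f g : E -> V) :
  open U -> (forall y, U y -> f y = g y) -> Ck_on k U f -> Ck_on k U g.
Proof.
move=> oU; elim: k f g => [|k IH] f g fg;
  have nfg y (Uy : U y) : \forall z \near y, f z = g z by
    near=> z; apply: fg; near: z; exact: open_nbhs_nbhs.
  rewrite !Ck_on0P => H y Uy.
  rewrite /prop_for /continuous_at -(fg _ Uy); exact: cvg_trans (near_eq_cvg (nfg _ Uy)) (H y Uy).
move=> [df Hf]; split=> [y Uy|a].
  by apply: near_eq_differentiable (nfg _ Uy) _; exact: df.
by apply: IH (Hf a) => y Uy; exact: near_eq_derive (nfg _ Uy).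
Unshelve. all: by end_near. Qed.

Lemma Ck_on_continuous (V : normedModType R) k (U : set E) (f : E -> V) y :
  Ck_on k U f -> U y -> {for y, continuous f}.
Proof.
case: k => [/Ck_on0P|k [+ _]] => H /H //; exact: differentiable_continuous.
Qed.

Lemma Ck_onS (V : normedModType R) k (U : set E) (f : E -> V) :
  Ck_on k.+1 U f -> Ck_on k U f.
Proof.
elim: k f => [|k IH] f Hf.
  by apply/Ck_on0P => y; exact: Ck_on_continuous Hf.
by split=> [|a]; [exact: Hf.1|apply: IH; exact: Hf.2].
Qed.

Lemma Ck_on_cst (V : normedModType R) k (U : set E) (c : V) :
  Ck_on k U (fun=> c).
Proof.
elim: k c => [|k IH] c; first by apply/Ck_on0P => y _; exact: cst_continuous.
split=> [y _|a]; first exact: differentiable_cst.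
by rewrite (_ : 'D__ _ = fun=> 0) //; apply/funext => y; exact: derive_cst.
Qed.

Lemma Ck_onD (V : normedModType R) k (U : set E) (f g : E -> V) :
  open U -> Ck_on k U f -> Ck_on k U g -> Ck_on k U (fun y => f y + g y).
Proof.
move=> oU; elim: k f g => [|k IH] f g.
  by rewrite !Ck_on0P => Hf Hg y Uy; exact: continuousD (Hf y Uy) (Hg y Uy).
move=> [df Hf] [dg Hg]; split=> [y Uy|a].
  have H1 := df y Uy; have H2 := dg y Uy.
  exact: (differentiableD H1 H2).
apply: (Ck_on_ext oU _ (IH _ _ (Hf a) (Hg a))) => y Uy.
by have H1 := df y Uy; have H2 := dg y Uy;
  rewrite deriveD//; exact: diff_derivable.
Qed.

Lemma Ck_on_sum (V : normedModType R) k (U : set E) I (r : seq I) (P : pred I)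
  (f : I -> E -> V) :
  open U -> (forall i, Ck_on k U (f i)) ->
  Ck_on k U (fun y => \sum_(i <- r | P i) f i y).
Proof.
move=> oU H; elim: r => [|i r IH].
  by under eq_fun do rewrite big_nil; exact: Ck_on_cst.
under eq_fun do rewrite big_cons.
by case: (P i) => //; exact: Ck_onD.
Qed.

Lemma Ck_onM k (U : set E) (f g : E -> R^o) :
  open U -> Ck_on k U f -> Ck_on k U g ->
  Ck_on k U (fun y => f y * g y : R^o).
Proof.
move=> oU; elim: k f g => [|k IH] f g.
  by rewrite !Ck_on0P => Hf Hg y Uy; exact: continuousM (Hf y Uy) (Hg y Uy).
move=> Hf Hg; split=> [y Uy|a].
  by apply: differentiableM; [exact: Hf.1|exact: Hg.1].
have HD : Ck_on k U (fun y => f y * 'D_(e_ a) g y + g y * 'D_(e_ a) f y : R^o).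
  by apply: Ck_onD => //; apply: IH => //; solve [exact: Ck_onS|exact: Hf.2|exact: Hg.2].
apply: (Ck_on_ext oU _ HD) => y Uy.
by rewrite deriveM//; apply: diff_derivable; [exact: Hf.1|exact: Hg.1].
Qed.

Lemma Ck_on_prod k (U : set E) I (r : seq I) (P : pred I) (f : I -> E -> R^o) :
  open U -> (forall i, Ck_on k U (f i)) ->
  Ck_on k U (fun y => \prod_(i <- r | P i) f i y : R^o).
Proof.
move=> oU H; elim: r => [|i r IH].
  by under eq_fun do rewrite big_nil; exact: Ck_on_cst.
under eq_fun do rewrite big_cons.
by case: (P i) => //; exact: Ck_onM.
Qed.

Lemma Ck_on_coord k (U : set E) b : Ck_on k U (fun y : E => y 0 b : R^o).
Proof.
case: k => [|k]; first by apply/Ck_on0P => y _; exact: coord_continuous.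
split=> [y _|a]; first exact: differentiable_coord.
rewrite (_ : 'D__ _ = fun=> (e_ a) 0 b); first exact: Ck_on_cst.
apply/funext => y.
have := @derive_mx R E 1 m id y (e_ a) (@derivable_id _ _ _ _).
by rewrite derive_id => /(congr1 (fun N : E => N 0 b)) ->; rewrite mxE.
Qed.

Lemma Ck_on_entry p q k (U : set E) (T : E -> 'M[R]_(p, q)) i j :
  open U -> Ck_on k U T -> Ck_on k U (fun y => T y i j : R^o).
Proof.
move=> oU; elim: k T => [|k IH] T.
  rewrite !Ck_on0P => H y Uy.
  exact: (continuous_comp (H y Uy) (@coord_continuous _ _ _ i j (T y))).
move=> [dT HT]; split=> [y Uy|a].
  apply: (@differentiable_comp _ _ _ _ T (fun N : 'M[R]_(p, q) => N i j : R^o)).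
    exact: dT.
  exact: differentiable_coord.
apply: (Ck_on_ext oU _ (IH _ (HT a))) => y Uy.
by rewrite derive_mx ?mxE//; apply: diff_derivable; exact: dT.
Qed.

Lemma derive_coord_sum (V : normedModType R) (f : E -> V) (y v : E) :
  differentiable f y -> 'D_v f y = \sum_a v 0 a *: 'D_(e_ a) f y.
Proof.
move=> df; rewrite deriveE// {1}(row_sum_delta v) linear_sum.
by apply: eq_bigr => a _; rewrite linearZ deriveE.
Qed.

End Ck_calculus.

Lemma derive_chain {R : realType} (m n : nat) (V : normedModType R)
    (F : 'rV[R]_n -> V) (T : 'rV[R]_m -> 'rV[R]_n) y v :
  differentiable T y -> differentiable F (T y) ->
  'D_v (F \o T) y = \sum_b ('D_v T y) 0 b *: 'D_(delta_mx 0 b) F (T y).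
Proof.
move=> dT dF; rewrite -derive_coord_sum// !deriveE//.
  by rewrite diff_comp.
exact: differentiable_comp.
Qed.

Lemma Ck_on_comp {R : realType} (m n k : nat) (U : set 'rV[R]_m)
    (W : set 'rV[R]_n) (F : 'rV[R]_n -> R^o) (T : 'rV[R]_m -> 'rV[R]_n) :
  open U -> open W -> (forall y, U y -> W (T y)) ->
  Ck_on k W F -> Ck_on k U T -> Ck_on k U (F \o T).
Proof.
move=> oU oW UW; elim: k F => [|k IH] F.
  rewrite !Ck_on0P => HF HT y Uy.
  exact: continuous_comp (HT y Uy) (HF _ (UW _ Uy)).
move=> HF HT; split=> [y Uy|a].
  exact: differentiable_comp (HT.1 y Uy) (HF.1 _ (UW _ Uy)).
have HD : Ck_on k U (fun y => \sum_b
    ('D_(delta_mx 0 a) T y) 0 b * ('D_(delta_mx 0 b) F \o T) y : R^o).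
  apply: Ck_on_sum => // b; apply: Ck_onM => //.
    by apply: Ck_on_entry => //; exact: HT.2.
  by apply: IH; [exact: HF.2|exact: Ck_onS].
apply: (Ck_on_ext oU _ HD) => y Uy; have dT := HT.1 y Uy.
by have dF := HF.1 _ (UW _ Uy); rewrite [RHS]derive_chain.
Qed.

(** The outer function is known only through its derivative at the values of [F]. This fits
    functions regular on a part of the line, such as powers of a primitive, and families stable
    under differentiation, such as [bump]. *)
Lemma Ck_on_comp1 {R : realType} (m k : nat) (U : set 'rV[R]_m)
    (s : R -> R) (ds : R -> R) (F : 'rV[R]_m -> R^o) :
  open U -> Ck_on k.+1 U F ->
  (forall y, U y -> is_derive (F y) 1 (s : R -> R^o) (ds (F y))) ->
  Ck_on k U ((ds \o F) : 'rV[R]_m -> R^o) ->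
  Ck_on k.+1 U ((s \o F) : 'rV[R]_m -> R^o).
Proof.
move=> oU HF Hs Hds.
have dF y : U y -> differentiable F y by exact: HF.1.
have ds1 y : U y -> differentiable (s : R^o -> R^o) (F y).
  by move=> Uy; apply/derivable1_diffP; have [] := Hs y Uy.
split=> [y Uy|a].
  exact: differentiable_comp (dF y Uy) (ds1 y Uy).
have HD : Ck_on k U (fun y => (ds \o F) y * 'D_(delta_mx 0 a) F y : R^o).
  by apply: Ck_onM => //; exact: HF.2.
apply: (Ck_on_ext oU _ HD) => y Uy.
rewrite [RHS]deriveE; last exact: differentiable_comp (dF y Uy) (ds1 y Uy).
have dFy := dF y Uy; have dsy := ds1 y Uy.
rewrite diff_comp//.
rewrite /= -[in RHS](deriveE _ dFy).
set d := 'D__ F y.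
have -> : 'd (s : R^o -> R^o) (F y) d = d *: 'd (s : R^o -> R^o) (F y) 1.
  by rewrite -linearZ/= [d *: 1]mulr1.
rewrite -deriveE//.
by rewrite (@derive_val _ _ _ _ _ _ _ (Hs y Uy)) mulrC.
Qed.

(** * A smooth bump function *)

Section smooth_bump.
Context {R : realType}.

(** [exp x] dominates [x ^ i / i!], so the monomial of degree [i] contributes at most [i!] times the
    absolute value of its coefficient. *)
Lemma horner_expRN_bounded (p : {poly R}) :
  exists2 C, 0 <= C & forall x, 0 < x -> `|p.[x]| * expR (- x) <= C.
Proof.
exists (\sum_(i < size p) `|p`_i| * (i`!)%:R).
  by apply: sumr_ge0 => i _; rewrite mulr_ge0.
move=> x x0; rewrite horner_coef.
apply: le_trans (_ : (\sum_(i < size p) `|p`_i * x ^+ i|) * expR (- x) <= _).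
  by rewrite ler_wpM2r ?expR_ge0// ler_norm_sum.
rewrite mulr_suml; apply: ler_sum => i _.
rewrite normrM -mulrA ler_wpM2l//.
rewrite ger0_norm ?exprn_ge0 ?(ltW x0)// expRN. rewrite ler_pdivrMr; last exact: expR_gt0.
case: (val i) => [|n]; first by rewrite expr0 fact0 mul1r -expR0 ler_expR ltW.
have := expR_ge1Dxn n (ltW x0).
have f0 : 0 < (n.+1`!)%:R :> R by rewrite ltr0n fact_gt0.
move=> /(ler_wpM2l (ltW f0)); rewrite mulrDr mulr1 mulrCA divff ?mulr1; last first.
  by rewrite gt_eqF.
by apply: le_trans; rewrite lerDr ltW.
Qed.

(* The factor [p (1 / t)] makes the family closed under differentiation. *)
Definition bump (p : {poly R}) (t : R) : R :=
  if 0 < t then p.[t^-1] * expR (- t^-1) else 0.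

(** In the variable [x = 1 / t], [d/dt] is [- x ^ 2 d/dx], and [p(x) exp (- x)] has derivative
    [(p' - p)(x) exp (- x)] in [x]. *)
Lemma is_derive_bump p (t : R) :
  is_derive t 1 (bump p : R -> R^o) (bump ('X^2 * (p - p^`())) t).
Proof.
have [t0|t0|->] := ltgtP t 0.
- rewrite {2}/bump ltNge (ltW t0)/=.
  apply: (@near_eq_is_derive _ _ _ (cst 0)).
  near=> s; rewrite /bump ltNge (_ : s <= 0)//.
  by near: s; exact: lt_le_nbhsl.
- rewrite {2}/bump t0.
  apply: (@near_eq_is_derive R R^o R^o (fun t : R^o => p.[t^-1] * expR (- t^-1) : R^o)).
    near=> s; rewrite /bump (_ : 0 < s)//.
    by near: s; exact: lt_nbhsr.
  have t0' : t != 0 by rewrite gt_eqF.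
  have dV : is_derive t 1 (fun s : R => s^-1) (- t ^- 2).
    have := @deriveV _ _ (@id R) t 1 t0' (@derivable_id _ _ _ _).
    rewrite derive_id => dE; split; first exact: derivableV.
    by rewrite dE; rewrite [_ *: _]mulr1.
  have d1 := is_derive1_comp (is_derive_poly p t^-1) dV.
  have d2 := @is_derive1_comp R expR (fun s => - s^-1) t _ _ (is_derive_expR _) (is_deriveN dV).
  apply: (is_derive_eq (is_deriveM d1 d2)).
  rewrite /= !hornerE -exprVn /GRing.scale/=; ring.
(* At 0, the bound for ['X^2 * p] at [1 / h] reads [|bump p h| <= C h ^ 2], so the difference
   quotients tend to 0. *)
rewrite {2}/bump ltxx; have [C C0 HC] := horner_expRN_bounded ('X^2 * p).
have bd (h : R) : `|bump p h| <= C * h ^+ 2.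
  rewrite /bump; case: ifPn => [h0|_]; last by rewrite normr0 mulr_ge0 ?sqr_ge0.
  have := HC h^-1; rewrite invr_gt0 => /(_ h0).
  rewrite hornerM hornerXn normrM normrX normfV (gtr0_norm h0).
  rewrite normrM [`|expR _|]gtr0_norm ?expR_gt0//.
  by rewrite -mulrA exprVn ler_pdivrMl ?exprn_gt0// [_ * C]mulrC.
have cv : (h^-1 *: (((bump p : R -> R^o) \o shift 0) (h *: 1) - bump p 0))
    @[h --> 0^'] --> (0 : R^o).
  apply/cvgrPdist_le => e e0; near=> h.
  rewrite sub0r normrN /= addr0 {2}/bump ltxx subr0 normrZ normfV.
  rewrite ler_pdivrMl; last by rewrite normr_gt0; near: h; exact: nbhs_dnbhs_neq.
  apply: le_trans (bd _) _; rewrite [_ *: 1]mulr1 -real_normK ?num_real//.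
  rewrite expr2 mulrA [leRHS]mulrC ler_wpM2r//.
  have : `|h| <= e / (C + 1).
    by near: h; apply: dnbhs0_le; rewrite divr_gt0// ltr_wpDl.
  rewrite ler_pdivlMr ?ltr_wpDl//; apply: le_trans.
  by rewrite mulrC ler_wpM2l// lerDl.
by split; [apply/cvg_ex; exists 0|exact: cvg_lim cv].
Unshelve. all: by end_near. Qed.

End smooth_bump.

Lemma bump_ge0 {R : realType} (t : R) : 0 <= bump 1 t.
Proof. by rewrite /bump hornerC mul1r; case: ifP => // _; exact: expR_ge0. Qed.

Lemma bump_gt0 {R : realType} (t : R) : (0 < bump 1 t) = (0 < t).
Proof.
by rewrite /bump hornerC mul1r; case: ifP => _; rewrite ?expR_gt0 ?ltxx.
Qed.

Lemma Ck_on_bump {R : realType} (m k : nat) (U : set 'rV[R]_m) (p : {poly R})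
    (F : 'rV[R]_m -> R^o) :
  open U -> Ck_on k U F -> Ck_on k U ((bump p \o F) : 'rV[R]_m -> R^o).
Proof.
move=> oU; elim: k p F => [|k IH] p F HF.
  apply/Ck_on0P => y Uy.
  apply: (continuous_comp (Ck_on_continuous HF Uy)).
  apply: (@differentiable_continuous _ R^o R^o); apply/derivable1_diffP.
  by have [] := is_derive_bump p (F y).
apply: (Ck_on_comp1 (ds := bump ('X^2 * (p - p^`())))) => // [y _|].
  exact: is_derive_bump.
by apply: IH; exact: Ck_onS.
Qed.

(** * Bernstein polynomials on a simplex *)

Section random_walk.
Context {R : realType} {m : nat}.
Local Notation E := 'rV[R]_m.
Local Notation e_ a := (delta_mx 0 a : 'rV[R]_m).
Variables (c : E) (lam : R).

(** The vertices are [c] and the points [c + L e_a]. The size is a parameter because a walk of [k]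
    steps of length [h] from [c] stays in the simplex of size [k h]. *)
Definition simplex (L : R) : set E :=
  [set y | (forall a, c 0 a <= y 0 a) /\ \sum_a (y 0 a - c 0 a) <= L].

(** Barycentric coordinates for the vertices [c + lam e_a], while [bary0] belongs to the vertex [c].
    On [simplex lam] they are nonnegative with sum 1, as transition probabilities must be. *)
Definition bary (a : 'I_m) (y : E) : R := (y 0 a - c 0 a) / lam.

Definition bary0 (y : E) : R := 1 - \sum_a bary a y.

(* The mean of [g] after [n] steps from [s], a step being [h e_a] with probability
   [bary a y] and 0 with probability [bary0 y]. For [h = lam / n] and [s = c] it is
   the Bernstein polynomial of [g], and its derivative is the mean of a
   difference quotient over [n - 1] steps. *)
Fixpoint walk (h : R) (n : nat) (g : E -> R) (y s : E) : R :=
  if n is n'.+1 then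
    \sum_a bary a y * walk h n' g y (s + h *: e_ a) + bary0 y * walk h n' g y s
  else g s.

Hypothesis lam0 : 0 < lam.

Lemma bary_ge0 a y : simplex lam y -> 0 <= bary a y.
Proof. by move=> [yc _]; rewrite divr_ge0 ?subr_ge0// ltW. Qed.

Lemma bary0_ge0 y : simplex lam y -> 0 <= bary0 y.
Proof.
by move=> [_ ys]; rewrite subr_ge0 -mulr_suml ler_pdivrMr ?mul1r.
Qed.

Lemma bary_le1 a y : simplex lam y -> bary a y <= 1.
Proof.
move=> ys; have := bary0_ge0 ys; rewrite subr_ge0; apply: le_trans.
by rewrite (bigD1 a)//= lerDl sumr_ge0// => b _; exact: bary_ge0.
Qed.

Lemma simplex_step L h a s : 0 <= h -> simplex L s ->
  simplex (L + h) (s + h *: e_ a).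
Proof.
move=> h0 [sc sL]; split=> [b|].
  by rewrite !mxE (le_trans (sc b))// lerDl mulr_ge0// ler0n.
have E b : (s + h *: e_ a) 0 b - c 0 b = (s 0 b - c 0 b) + h * (b == a)%:R.
  by rewrite !mxE eqxx/= addrAC.
under eq_bigr do rewrite E.
rewrite big_split/= lerD// (bigD1 a)//= eqxx mulr1.
by rewrite big1 ?addr0// => b /negbTE ->; rewrite mulr0.
Qed.

Lemma simplexW L L' : L <= L' -> simplex L `<=` simplex L'.
Proof. by move=> LL y [yc yL]; split=> //; exact: le_trans LL. Qed.

(** For [y] in the simplex all weights are nonnegative, and the walk started in [simplex L] ends in
    [simplex (L + n h)], so the comparison of [g] and [g'] matters there only. *)
Lemma walk_le L h n g g' y s : 0 <= h -> simplex lam y -> simplex L s ->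
  (forall z, simplex (L + n%:R * h) z -> g z <= g' z) ->
  walk h n g y s <= walk h n g' y s.
Proof.
move=> h0 ys; elim: n L s => [|n IH] L s Ls gg /=.
  by apply: gg; rewrite mul0r addr0.
apply: lerD; [apply: ler_sum => a _|]; apply: ler_wpM2l.
- exact: bary_ge0.
- apply: (IH (L + h)); first exact: simplex_step.
  by move=> z Lz; apply: gg; move: Lz; rewrite -addrA -nat1r mulrDl mul1r.
- exact: bary0_ge0.
- apply: (IH L) => // z Lz; apply: gg; apply: simplexW Lz.
  by rewrite lerD2l ler_wpM2r// ler_nat.
Qed.

Lemma walk_lin h n k g g' y s :
  walk h n (fun z => k * g z + g' z) y s = k * walk h n g y s + walk h n g' y s.
Proof.
elim: n s => [//|n IH] s /=.
under eq_bigr do rewrite IH mulrDr mulrCA.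
by rewrite IH big_split/= -mulr_sumr; ring.
Qed.

Lemma walk_cst h n k y s : walk h n (fun=> k) y s = k.
Proof.
elim: n s => [//|n IH] s /=; under eq_bigr do rewrite IH.
by rewrite IH -mulr_suml -mulrDl /bary0 addrC subrK mul1r.
Qed.

(** The weights depend on [y] and not on the site [s], so the walk commutes with translations. *)
Lemma walk_shift h n g y s v :
  walk h n g y (s + v) = walk h n (fun z => g (z + v)) y s.
Proof.
elim: n s => [//|n IH] s /=; rewrite IH; congr (_ + _).
by apply: eq_bigr => a _; rewrite addrAC IH.
Qed.

Lemma Ck_on_bary k U a : open U -> Ck_on k U (bary a : E -> R^o).
Proof.
move=> oU; apply: Ck_onM => //; last exact: Ck_on_cst.
by apply: Ck_onD => //; [exact: Ck_on_coord|exact: Ck_on_cst].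
Qed.

Lemma Ck_on_bary0 k U : open U -> Ck_on k U (bary0 : E -> R^o).
Proof.
move=> oU; have -> : bary0 = (fun y => 1 + (- 1) * \sum_a bary a y).
  by apply/funext => y; rewrite mulN1r.
apply: Ck_onD => //; first exact: Ck_on_cst.
apply: Ck_onM => //; first exact: Ck_on_cst.
by apply: Ck_on_sum => // a; exact: Ck_on_bary.
Qed.

Lemma Ck_on_walk k U h n g s : open U ->
  Ck_on k U ((fun y => walk h n g y s) : E -> R^o).
Proof.
move=> oU; elim: n s => [|n IH] s; first exact: Ck_on_cst.
apply: Ck_onD => //; last by apply: Ck_onM => //; exact: Ck_on_bary0.
by apply: Ck_on_sum => // a; apply: Ck_onM => //; exact: Ck_on_bary.
Qed.

Lemma walk_sum h n I (r : seq I) (g : I -> E -> R) y s :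
  walk h n (fun z => \sum_(i <- r) g i z) y s = \sum_(i <- r) walk h n (g i) y s.
Proof.
elim: r => [|i r IH].
  by under eq_fun do rewrite big_nil; rewrite walk_cst big_nil.
under eq_fun do rewrite big_cons.
rewrite big_cons -IH -[walk _ _ (g i) _ _]mul1r -walk_lin.
by congr (walk _ _ _ _ _); apply/funext => z; rewrite mul1r.
Qed.

(** The coordinate [a] of the endpoint is [s 0 a] plus [h] times a binomial variable of parameters
    [n] and [bary a y]: its second moment about [b] is the squared bias plus the variance. *)
Lemma walk_moment h n a b y s :
  walk h n (fun z => (z 0 a - b) ^+ 2) y s =
  (s 0 a + n%:R * h * bary a y - b) ^+ 2 +
  n%:R * h ^+ 2 * bary a y * (1 - bary a y).
Proof.
elim: n s => [|n IH] s /=; first by rewrite !mul0r !addr0.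
pose S r := (r + n%:R * h * bary a y - b) ^+ 2 +
  n%:R * h ^+ 2 * bary a y * (1 - bary a y).
have E : \sum_(i | i != a) bary i y * S ((s + h *: e_ i) 0 a) =
    (\sum_(i | i != a) bary i y) * S (s 0 a).
  rewrite mulr_suml; apply: eq_bigr => i ia; rewrite !mxE eqxx/=.
  by rewrite eq_sym (negbTE ia) mulr0 addr0.
under eq_bigr do rewrite IH.
rewrite IH (bigD1 a)//= -!/(S _) E /S.
have -> : (s + h *: e_ a) 0 a = s 0 a + h by rewrite !mxE !eqxx mulr1.
by rewrite /bary0 [in X in _ + X * _ = _](bigD1 a)//= -nat1r; ring.
Qed.

(** With [n.+1] steps the walk has mean [y], and only the variance is left. With [n] steps, the
    count for the derivative, the mean misses [y] by [h * bary a y]; the square of this, at most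
    [h ^ 2], takes in the bound the place of the missing step. *)
Lemma walk_moment_le n k a y : simplex lam y -> (k == n) || (k == n.+1) ->
  walk (lam / n.+1%:R) k (fun z => (z 0 a - y 0 a) ^+ 2) y c <=
  lam ^+ 2 / n.+1%:R.
Proof.
move=> ys kn; rewrite walk_moment; set h := lam / _; set t := bary a y.
have t0 : 0 <= t by exact: bary_ge0.
have t1 : t <= 1 by exact: bary_le1.
have n0 : n.+1%:R != 0 :> R by [].
have -> : lam ^+ 2 / n.+1%:R = n.+1%:R * h ^+ 2 by rewrite /h; field.
have -> : y 0 a = c 0 a + n.+1%:R * h * t.
  by rewrite /h /t /bary; field; rewrite gt_eqF//= nat1r n0.
have hh : 0 <= h ^+ 2 by rewrite sqr_ge0.
have n00 : 0 <= n%:R :> R by rewrite ler0n.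
have key x : 0 <= x -> x * t * (1 - t) <= x.
  by move=> x0; rewrite -mulrA ler_piMr// mulr_ile1 ?subr_ge0// lerBlDr lerDl.
move: kn => /orP[]/eqP->.
  have -> : c 0 a + n%:R * h * t - (c 0 a + n.+1%:R * h * t) = - (h * t).
    by rewrite -nat1r; ring.
  rewrite -nat1r sqrrN exprMn mulrDl mul1r lerD//.
    by rewrite ler_piMr// exprn_ile1.
  by apply: key; rewrite mulr_ge0.
by rewrite subrr expr0n/= add0r key// mulr_ge0.
Qed.

Lemma is_derive_bary a b y :
  is_derive y (e_ a) (bary b : E -> R^o) ((b == a)%:R / lam).
Proof.
have dc : is_derive y (e_ a) (fun y : E => y 0 b : R^o) ((b == a)%:R).
  split; first by apply: diff_derivable; exact: differentiable_coord.
  have := @derive_mx R E 1 m id y (e_ a) (@derivable_id _ _ _ _).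
  by rewrite derive_id => /(congr1 (fun N : E => N 0 b)); rewrite !mxE eqxx/= => ->.
have dd := is_deriveD dc (is_derive_cst (- c 0 b : R^o) y (e_ a)).
have := is_deriveM dd (is_derive_cst (lam^-1 : R^o) y (e_ a)).
move=> dm; apply: (is_derive_eq dm).
by rewrite scaler0 add0r addr0 /GRing.scale/= mulrC.
Qed.

Lemma is_derive_bary0 a y : is_derive y (e_ a) (bary0 : E -> R^o) (- lam^-1).
Proof.
have ds := @is_derive_sum _ _ _ _ bary y (e_ a) _ (fun b => is_derive_bary a b y).
have d := is_deriveB (is_derive_cst (1 : R^o) y (e_ a)) ds.
have E : cst 1 - \sum_b bary b = bary0.
  by apply/funext => z; rewrite /bary0 /=; congr (_ - _); by rewrite fct_sumE.
rewrite E in d; apply: (is_derive_eq d).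
by rewrite (bigD1 a)//= eqxx big1 ?addr0 ?mul1r ?sub0r// => b /negbTE->; rewrite mul0r.
Qed.

(** Differentiating the weights of one step along [e_a] replaces its mean by the difference between
    the step [h e_a] and the null step, divided by [lam]. The [n] steps contribute equally, since by
    translation invariance this difference can be moved onto [g]. *)
Lemma is_derive_walk h n g y s a :
  is_derive y (e_ a) ((fun y => walk h n g y s) : E -> R^o)
    (n%:R / lam * walk h n.-1 (fun z => g (z + h *: e_ a) - g z) y s).
Proof.
pose dg (z : E) := g (z + h *: e_ a) - g z; rewrite -/dg.
elim: n s => [|n IH] s.
  by rewrite !mul0r; exact: is_derive_cst.
have ds : is_derive y (e_ a)
    (\sum_b (fun y => bary b y * walk h n g y (s + h *: e_ b) : R^o))
    (\sum_b (bary b y * (n%:R / lam * walk h n.-1 dg y (s + h *: e_ b)) +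
       walk h n g y (s + h *: e_ b) * ((b == a)%:R / lam))).
  by apply: is_derive_sum => b; exact: (is_deriveM (is_derive_bary a b y) (IH _)).
have d0 := is_deriveM (is_derive_bary0 a y) (IH s).
have := is_deriveD ds d0; set F := (X in is_derive _ _ X _ -> _).
have -> : F = (fun y => walk h n.+1 g y s).
  apply/funext => z; rewrite /F/=; congr (_ + _); by rewrite fct_sumE.
move=> dw; apply: (is_derive_eq dw).
rewrite big_split/= [X in _ + X + _](_ : _ = walk h n g y (s + h *: e_ a) / lam); last first.
  rewrite (bigD1 a)//= eqxx mul1r big1 ?addr0// => b /negbTE->.
  by rewrite mul0r mulr0.
have -> : walk h n g y (s + h *: e_ a) = walk h n dg y s + walk h n g y s.
  rewrite walk_shift -[walk _ _ dg _ _]mul1r -walk_lin.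
  by congr (walk _ _ _ _ _); apply/funext => z; rewrite mul1r /dg subrK.
(* For [n > 0] the outer step completes [n.-1] steps to [n]; for [n = 0], where [n.-1] is 0 as well,
   the factor [n] makes both sides vanish. *)
have E : (\sum_b bary b y * (n%:R / lam * walk h n.-1 dg y (s + h *: e_ b)) +
   bary0 y * (n%:R / lam * walk h n.-1 dg y s)) = n%:R / lam * walk h n dg y s.
  case: (n) => [|k]; first by rewrite !mul0r mulr0 addr0 big1// => b _; rewrite mul0r mulr0.
  rewrite /= mulrDr mulr_sumr; congr (_ + _); last by rewrite mulrCA.
  by apply: eq_bigr => b _; rewrite mulrCA.
rewrite /GRing.scale/= -nat1r.
transitivity ((\sum_b bary b y * (n%:R / lam * walk h n.-1 dg y (s + h *: e_ b)) +
   bary0 y * (n%:R / lam * walk h n.-1 dg y s)) + lam^-1 * walk h n dg y s); first ring.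
by rewrite E; ring.
Qed.

End random_walk.

Lemma exists_nat_ge {R : archiRealFieldType} (x : R) : exists n : nat, x <= n%:R.
Proof.
exists (Num.bound `|x|); apply: le_trans (ler_norm x) _.
by apply: ltW; exact: archi_boundP.
Qed.

(** Continuity at the points of [K] is meant in the whole space, so [z] may leave [K]. *)
Lemma compact_unif_continuous {R : realType} (V W : normedModType R) (K : set V)
    (g : V -> W) (e : R) :
  compact K -> (forall x, K x -> {for x, continuous g}) -> 0 < e ->
  exists2 d : R, 0 < d & forall x z, K x -> `|z - x| < d -> `|g z - g x| < e.
Proof.
move=> /compact_near_coveringP cK cg e0.
have : \forall d \near 0^'+, K `<=` [set x | forall z, `|z - x| < d -> `|g z - g x| < e].
  apply: (cK R (0^'+) (fun d x => forall z, `|z - x| < d -> `|g z - g x| < e)).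
  move=> x Kx.
  have := cg x Kx => /cvgrPdist_lt/(_ (e / 2)) /[!divr_gt0]// /(_ isT)/nbhs_ballP[r /= r0 rg].
  exists (ball x (r / 2), [set d : R | d < r / 2]).
    split; first by apply: nbhsx_ballx; rewrite divr_gt0.
    by apply: nbhs_right_lt; rewrite divr_gt0.
  move=> [x' d] [/= x'r dr] z zd.
  have gx' : `|g x - g x'| < e / 2.
    by apply: rg; apply: le_ball x'r; rewrite ler_pdivrMr// ler_peMr ?ler1n// ltW.
  have gz : `|g x - g z| < e / 2.
    apply: rg; rewrite -ball_normE/= (_ : x - z = (x - x') - (z - x')); last first.
      by rewrite opprB addrA subrK.
    rewrite (le_lt_trans (ler_normB _ _))// [ltRHS]splitr ltrD//.
      by move: x'r; rewrite -ball_normE.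
    exact: lt_trans dr.
  rewrite (_ : g z - g x' = (g x - g x') - (g x - g z)); last first.
    by rewrite opprB [RHS]addrC subrKA.
  by rewrite (le_lt_trans (ler_normB _ _))// [ltRHS]splitr ltrD.
move=> H; near (0 : R)^'+ => d; exists d; first by [].
by move=> x z Kx; apply: (near H d).
Unshelve. all: by end_near. Qed.

(** * C^1 convergence of Bernstein polynomials *)

Section Bernstein.
Context {R : realType} {m : nat}.
Local Notation E := 'rV[R]_m.
Local Notation e_ a := (delta_mx 0 a : 'rV[R]_m).
Variables (c : E) (lam : R).
Hypothesis lam0 : 0 < lam.
Local Notation K := (simplex c lam).

Lemma simplex_compact L : compact (simplex c L).
Proof.
have cs : continuous (fun y : E => \sum_a (y 0 a - c 0 a) : R^o).
  move=> y; apply: (@Ck_on_continuous _ _ _ 0 setT) => //.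
  apply: Ck_on_sum => [|a]; first exact: openT.
  apply: Ck_onD; [exact: openT|exact: Ck_on_coord|exact: Ck_on_cst].
apply: (@subclosed_compact _ _
    [set v : 'rV[R]_m | forall i, `[c 0 i, c 0 i + L]%classic (v ord0 i)]).
- rewrite (_ : simplex c L = \bigcap_a [set y : E | c 0 a <= y 0 a] `&`
      [set y : E | \sum_a (y 0 a - c 0 a) <= L]); last first.
    by apply/seteqP; split => y [yc yL]; split=> // a; [move=> _|]; exact: yc.
  apply: closedI.
    apply: closed_bigI => a _.
    apply: (@preimage_closed _ _ (fun y : E => y 0 a) [set x | c 0 a <= x]).
      by move=> y _; exact: coord_continuous.
    exact: closed_ge.
  apply: (@preimage_closed _ _ (fun y : E => \sum_a (y 0 a - c 0 a)) [set x | x <= L]).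
    by move=> y _; exact: cs.
  exact: closed_le.
- apply: (@rV_compact R m (fun i => `[c 0 i, c 0 i + L]%classic)) => i.
  exact: segment_compact.
- move=> y [yc yL] a /=; rewrite in_itv/= yc/= -lerBlDl (le_trans _ yL)//.
  by rewrite (bigD1 a)//= lerDl sumr_ge0// => b _; rewrite subr_ge0.
Qed.

Lemma simplex_step_le n k :
  (k <= n.+1)%N -> k%:R * (lam / n.+1%:R) <= lam :> R.
Proof.
move=> kn; rewrite mulrCA ler_piMr ?(ltW lam0)// ler_pdivrMr// mul1r ler_nat//.
Qed.

(** Chebyshev's argument: the oscillation of [g0] is at most a small constant plus a multiple of the
    squared distance, whose mean under the walk tends to 0. The integrand [G n] may depend on [n],
    so that one statement serves the polynomials, with [q] and [n.+1] steps, and their derivatives,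
    with difference quotients and [n] steps. *)
Lemma walk_cvg (g0 : E -> R) (G : nat -> E -> R) (k : nat -> nat) :
  (forall n, (k n == n) || (k n == n.+1)) ->
  (forall y, K y -> {for y, continuous (g0 : E -> R^o)}) ->
  (forall e : R, 0 < e -> \forall n \near \oo,
     forall z, simplex c ((k n)%:R * (lam / n.+1%:R)) z -> `|G n z - g0 z| <= e) ->
  forall e : R, 0 < e -> \forall n \near \oo,
    forall y, K y -> `|walk c lam (lam / n.+1%:R) (k n) (G n) y c - g0 y| <= e.
Proof.
move=> kn cg HG e e0.
have e40 : 0 < e / 4 by rewrite divr_gt0.
have [d d0 dg] := compact_unif_continuous (@simplex_compact lam) cg e40.
have [M M0 HM] : exists2 M, 0 <= M & forall y, K y -> `|g0 y| <= M.
  have cg' : {within K, continuous (g0 : E -> R^o)}.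
    by apply: continuous_in_subspaceT => y /set_mem; exact: cg.
  have [M [Mr HM]] := compact_bounded (continuous_compact cg' (@simplex_compact lam)).
  exists (`|M| + 1); first by rewrite addr_ge0.
  move=> y Ky; apply: HM; last by exists y.
  by rewrite (le_lt_trans (ler_norm _))// ltrDl.
(* At distance at least [d] the oscillation is at most [2 M], which is [C d ^ 2]. *)
pose C := 2 * M / d ^+ 2.
have C0 : 0 <= C by apply: divr_ge0; [exact: mulr_ge0|exact: sqr_ge0].
have osc z y : K z -> K y ->
    `|g0 z - g0 y| <= e / 4 + C * \sum_a (z 0 a - y 0 a) ^+ 2.
  move=> Kz Ky.
  have S0 : 0 <= \sum_a (z 0 a - y 0 a) ^+ 2 by apply: sumr_ge0 => a _; exact: sqr_ge0.
  have [zy|zy] := ltP `|z - y| d.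
    by rewrite (le_trans (ltW (dg _ _ Ky zy)))// lerDl mulr_ge0.
  have : d ^+ 2 <= \sum_a (z 0 a - y 0 a) ^+ 2.
    (* The norm is the maximum of the coordinates, so a single coordinate accounts for the whole
       distance. *)
    have /(@mx_norm_neq0 _ _ _ (z - y))[[i a]] : mx_norm (z - y) != 0.
      by rewrite gt_eqF// (lt_le_trans d0 zy).
    move=> E; have {}E : `|z - y| = `|(z - y) i a| by exact: E.
    rewrite (bigD1 a)//=; apply: ler_wpDr; first by apply: sumr_ge0 => b _; exact: sqr_ge0.
    rewrite -[leRHS]real_normK ?num_real// lerXn2r ?nnegrE ?(ltW d0)//.
    by rewrite (le_trans zy)// E ord1 !mxE.
  move=> dS; apply: (@le_trans _ _ (C * d ^+ 2)).
    rewrite /C divfK ?expf_neq0 ?gt_eqF//.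
    by rewrite (le_trans (ler_normB _ _))// mulr_natl mulr2n lerD// HM.
  by rewrite ler_wpDl ?(ltW e40)// ler_wpM2l.
have ev : \forall n \near \oo, C * (m%:R * (lam ^+ 2 / n.+1%:R)) <= e / 2.
  have [n0 Hn0] := exists_nat_ge (C * (m%:R * lam ^+ 2) / (e / 2)).
  exists n0 => // n /= n0n.
  have -> : C * (m%:R * (lam ^+ 2 / n.+1%:R)) = C * (m%:R * lam ^+ 2) / n.+1%:R.
    by rewrite !mulrA.
  rewrite ler_pdivrMr// [leRHS]mulrC.
  rewrite -ler_pdivrMr ?divr_gt0// (le_trans Hn0)// ler_nat.
  exact: leq_trans n0n _.
near=> n => y Ky.
have HGn : forall z, simplex c ((k n)%:R * (lam / n.+1%:R)) z -> `|G n z - g0 z| <= e / 4.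
  by near: n; exact: (HG _ e40).
set h := lam / _ in HGn *.
have h0 : 0 <= h by rewrite divr_ge0// ltW.
have kL : (k n)%:R * h <= lam.
  by apply: simplex_step_le; case/orP: (kn n) => /eqP->; rewrite ?leqnSn.
pose Q (z : E) := \sum_a (z 0 a - y 0 a) ^+ 2.
have Qle : C * walk c lam h (k n) Q y c <= e / 2.
  apply: le_trans (_ : C * (m%:R * (lam ^+ 2 / n.+1%:R)) <= _); last by near: n.
  rewrite ler_wpM2l// /Q walk_sum.
  rewrite -[in leRHS](card_ord m) mulr_natl -sumr_const.
  by apply: ler_sum => a _; exact: walk_moment_le.
have c0 : simplex c 0 c.
  by split=> //; rewrite big1// => a _; rewrite subrr.
(* A quarter of [e] is spent on [G n - g0] and a quarter on the oscillation at small distance; the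
   other half is left for the mean of [C * Q]. *)
have bd z : simplex c (0 + (k n)%:R * h) z ->
    `|G n z - g0 y| <= e / 2 + C * Q z.
  rewrite add0r => zs; rewrite -(subrKA (g0 z)) (le_trans (ler_normD _ _))//.
  have -> : e / 2 + C * Q z = e / 4 + (e / 4 + C * Q z) by field.
  by apply: lerD; [exact: HGn|apply: osc => //; exact: simplexW zs].
rewrite ler_distl; apply/andP; split.
  apply: le_trans (_ : walk c lam h (k n) (fun z => - C * Q z + (g0 y - e / 2)) y c <= _).
    rewrite walk_lin walk_cst; move: Qle; lra.
  apply: (walk_le lam0 h0 Ky c0) => z /bd; rewrite ler_norml => /andP[]; lra.
apply: le_trans (_ : _ <= walk c lam h (k n) (fun z => C * Q z + (g0 y + e / 2)) y c) _.
  apply: (walk_le lam0 h0 Ky c0) => z /bd; rewrite ler_norml => /andP[]; lra.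
rewrite walk_lin walk_cst; move: Qle; lra.
Unshelve. all: by end_near. Qed.

Variables (U : set E) (q : E -> R^o).
Hypotheses (KU : K `<=` U) (q_C1 : Ck_on 1 U q).

Definition bernstein (n : nat) (y : E) : R :=
  walk c lam (lam / n.+1%:R) n.+1 q y c.

Lemma bernstein_ge0 n y : (forall z, K z -> 0 <= q z) -> K y -> 0 <= bernstein n y.
Proof.
move=> q0 Ky; rewrite -[leLHS](walk_cst c lam (lam / n.+1%:R) n.+1 0 y c).
apply: (@walk_le _ _ c lam lam0 0) => //.
- by rewrite divr_ge0// ltW.
- by split=> //; rewrite big1// => a _; rewrite subrr.
- by move=> z; rewrite add0r => zs; apply: q0; apply: simplexW zs; exact: simplex_step_le.
Qed.

Lemma bernstein_cvg (e : R) : 0 < e -> \forall n \near \oo,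
  forall y, K y -> `|bernstein n y - q y| <= e.
Proof.
apply: (@walk_cvg q (fun=> q) S).
- by move=> n; rewrite eqxx orbT.
- by move=> y /KU; exact: Ck_on_continuous q_C1.
- by move=> d d0; near=> n => z _; rewrite subrr normr0 ltW.
Unshelve. all: by end_near. Qed.

Lemma is_derive_line (y : E) (a : 'I_m) (r : R) : differentiable q (y + r *: e_ a) ->
  is_derive (r : R^o) 1 (fun r => q (y + r *: e_ a)) ('D_(e_ a) q (y + r *: e_ a)).
Proof.
move=> dq.
have E : (fun h : R => h^-1 *: (((fun r : R^o => q (y + r *: e_ a)) \o shift (r : R^o)) (h *: 1) -
   q (y + r *: e_ a))) =
   (fun h : R => h^-1 *: ((q \o shift (y + r *: e_ a)) (h *: e_ a) - q (y + r *: e_ a))).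
  by apply/funext => h /=; rewrite scalerDl [h *: 1]mulr1 addrCA.
have Hd : derivable q (y + r *: e_ a) (e_ a) by exact: diff_derivable.
by split; [rewrite /derivable E|rewrite /derive E].
Qed.

(** The derivative is a walk of [n] steps applied to difference quotients of [q] with increment
    [h = lam / n.+1]. The points reached lie in the simplex of size [n h], which leaves room for one
    more step inside [K]; there the mean value theorem turns each quotient into a value of the
    partial derivative at distance less than [h]. *)
Lemma derive_bernstein_cvg a (e : R) : 0 < e -> \forall n \near \oo,
  forall y, K y -> `|'D_(e_ a) (bernstein n : E -> R^o) y - 'D_(e_ a) q y| <= e.
Proof.
pose G n z := n.+1%:R / lam * (q (z + (lam / n.+1%:R) *: e_ a) - q z) : R.
have DE n y : 'D_(e_ a) (bernstein n : E -> R^o) y =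
    walk c lam (lam / n.+1%:R) n (G n) y c.
  rewrite (@derive_val _ _ _ _ _ _ _ (@is_derive_walk R m c lam (lam / n.+1%:R) n.+1 q y c a)) /=.
  (* The constant function 0 is added so that linearity can bring the factor [n.+1 / lam] under the
     walk. *)
  rewrite -[LHS]addr0 -(walk_cst c lam (lam / n.+1%:R) n 0 y c) -walk_lin.
  by congr (walk _ _ _ _ _); apply/funext => z; rewrite addr0.
move=> e0; suff : \forall n \near \oo, forall y, K y ->
    `|walk c lam (lam / n.+1%:R) n (G n) y c - 'D_(e_ a) q y| <= e.
  by apply: filterS => n H y Ky; rewrite DE; exact: H.
move: e e0; apply: (@walk_cvg ('D_(e_ a) q) G id).
- by move=> n; rewrite eqxx.
- by move=> y /KU Uy; exact: (@Ck_on_continuous _ _ _ 0 U _ _ (q_C1.2 a) Uy).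
move=> e e0.
have cD y : K y -> {for y, continuous ('D_(e_ a) q : E -> R^o)}.
  by move=> /KU Uy; exact: (@Ck_on_continuous _ _ _ 0 U _ _ (q_C1.2 a) Uy).
have [d d0 dg] := compact_unif_continuous (@simplex_compact lam) cD e0.
have ev : \forall n \near \oo, lam / n.+1%:R < d.
  have [n0 Hn0] := exists_nat_ge (lam / d).
  exists n0 => // n /= n0n; rewrite ltr_pdivrMr// mulrC -ltr_pdivrMr//.
  by rewrite (le_lt_trans Hn0)// ltr_nat ltnS.
near=> n => z zs; rewrite /G.
have hd : lam / n.+1%:R < d by near: n.
set h := lam / _ in hd *.
have h0 : 0 < h by rewrite divr_gt0.
have Kzr r : 0 <= r -> r <= h -> K (z + r *: e_ a).
  move=> r0 rh; apply: simplexW (@simplex_step R m c _ r a z r0 zs).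
  have hl : lam = n%:R * h + h by rewrite /h -nat1r; field; rewrite nat1r.
  by rewrite [leRHS]hl lerD2l.
have dline r : 0 <= r -> r <= h ->
    is_derive (r : R^o) 1 (fun r => q (z + r *: e_ a)) ('D_(e_ a) q (z + r *: e_ a)).
  by move=> r0 rh; apply: is_derive_line; apply: q_C1.1; apply: KU; exact: Kzr.
have cline : {within `[0, h], continuous (fun r : R => q (z + r *: e_ a))}.
  apply: derivable_within_continuous => r; rewrite in_itv/= => /andP[r0 rh].
  by have [] := dline r r0 rh.
have dopen (r : R) : r \in `]0, h[ ->
    is_derive r 1 (fun r => q (z + r *: e_ a)) ('D_(e_ a) q (z + r *: e_ a)).
  by rewrite in_itv/= => /andP[r0 rh]; apply: dline; exact: ltW.
have [r] := @MVT _ (fun r => q (z + r *: e_ a)) (fun r => 'D_(e_ a) q (z + r *: e_ a))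
  0 h h0 dopen cline.
rewrite in_itv/= => /andP[r0 rh]; rewrite subr0 scale0r addr0 => ->.
rewrite mulrCA (_ : n.+1%:R / lam * h = 1) ?mulr1; last first.
  by rewrite /h mulrA divfK ?divff// gt_eqF.
apply/ltW/dg; first by have := Kzr 0 (lexx 0) (ltW h0); rewrite scale0r addr0.
have ne : `|e_ a| <= 1.
  rewrite /Num.Def.normr/= mx_normrE; apply: bigmax_le => // -[i j] _.
  by rewrite mxE; case: (_ && _); rewrite ?normr1 ?normr0.
rewrite addrC addKr normrZ gtr0_norm//; apply: le_lt_trans (_ : h < d).
  by rewrite (le_trans _ (ltW rh))// ler_piMr// ltW.
exact: hd.
Unshelve. all: by end_near. Qed.

End Bernstein.

(** * Riemannian calculus *)

Lemma open_setI_preimage {S T : topologicalType} (f : S -> T) (U : set S) (O : set T) :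
  open U -> open O -> (forall x, U x -> {for x, continuous f}) ->
  open (U `&` f @^-1` O).
Proof.
move=> oU oO cf; rewrite openE => x [Ux Ofx]; apply: filterI.
  exact: open_nbhs_nbhs.
by apply: (cf x Ux); exact: open_nbhs_nbhs.
Qed.

Section Ck_matrix.
Context {R : realType} {m : nat}.
Variables (U : set 'rV[R]_m).
Hypothesis oU : open U.

Lemma Ck_on_det k n (G : 'rV[R]_m -> 'M[R]_n) :
  (forall a b, Ck_on k U (fun y => G y a b : R^o)) ->
  Ck_on k U (fun y => \det (G y) : R^o).
Proof.
move=> HG; apply: Ck_on_sum => // s; apply: Ck_onM => //; first exact: Ck_on_cst.
by apply: Ck_on_prod.
Qed.

(** Cramer's formula: each entry is a cofactor divided by the determinant, which does not vanish on
    [U]. *)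
Lemma continuous_invmx n (G : 'rV[R]_m -> 'M[R]_n) a b :
  (forall a b, Ck_on 0 U (fun y => G y a b : R^o)) ->
  (forall y, U y -> G y \in unitmx) ->
  Ck_on 0 U (fun y => invmx (G y) a b : R^o).
Proof.
move=> HG uG.
have Hd : Ck_on 0 U (fun y => (\det (G y))^-1 : R^o).
  apply/Ck_on0P => y Uy; apply: continuousV; last exact: Ck_on_continuous (Ck_on_det HG) Uy.
  by move: (uG y Uy); rewrite unitmxE unitfE.
have Ha : Ck_on 0 U (fun y => (\adj (G y)) a b : R^o).
  have -> : (fun y => (\adj (G y)) a b : R^o) = (fun y => cofactor (G y) b a).
    by apply/funext => y; rewrite mxE.
  apply: Ck_onM => //; first exact: Ck_on_cst.
  apply: Ck_on_det => s t.
  by have -> : (fun y => row' b (col' a (G y)) s t : R^o) =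
    (fun y => G y (lift b s) (lift a t)) by apply/funext => y; rewrite !mxE.
apply: (Ck_on_ext oU _ (Ck_onM oU Hd Ha)) => y Uy.
by rewrite /invmx (uG _ Uy) [RHS]mxE.
Qed.

End Ck_matrix.

Section chart_calculus.
Context {R : realType} {m : nat} {M : ptopologicalType}.
Variables (A : smooth_atlas R m M) (g : riemannian_metric A).
Local Notation E := 'rV[R]_m.
Local Notation e_ a := (delta_mx 0 a : 'rV[R]_m).
Local Notation dom i := (@chart_dom R m M A i).
Local Notation im i := (@chart_im R m M A i).
Local Notation ch i := (@chart R m M A i).
Local Notation inv i := (@chart_inv R m M A i).

Lemma chart_imP i x : dom i x -> im i (ch i x).
Proof. by move=> dx; exists x. Qed.

Lemma chart_invK i x : dom i x -> inv i (ch i x) = x.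
Proof. by move=> dx; apply: chartK; rewrite inE. Qed.

Lemma chart_inv_dom i y : im i y -> dom i (inv i y).
Proof. by move=> [x dx <-]; rewrite chart_invK. Qed.

Lemma chartVK i y : im i y -> ch i (inv i y) = y.
Proof. by move=> [x dx <-]; rewrite chart_invK. Qed.

Lemma chart_cts i x : dom i x -> {for x, continuous (ch i)}.
Proof. by move=> dx; apply: chart_continuous; rewrite inE. Qed.

Lemma chart_inv_cts i y : im i y -> {for y, continuous (inv i)}.
Proof. by move=> dx; apply: chart_inv_continuous; rewrite inE. Qed.

Lemma open_chart_preimage i (O : set M) :
  open O -> open (im i `&` inv i @^-1` O).
Proof.
by move=> oO; apply: open_setI_preimage => //; [exact: chart_im_open|exact: chart_inv_cts].
Qed.

Lemma chart_overlapE i j :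
  ch i @` (dom i `&` dom j) = im i `&` inv i @^-1` (dom j).
Proof.
apply/seteqP; split => [y [x [xi xj] <-]|y [yi yj]].
  by split; [exact: chart_imP|rewrite /= chart_invK].
exists (inv i y); last exact: chartVK.
by split => //; exact: chart_inv_dom.
Qed.

Lemma chart_trans_Ck k i j :
  Ck_on k (im i `&` inv i @^-1` (dom j)) (ch j \o inv i).
Proof. by rewrite -chart_overlapE; exact: chart_trans_smooth. Qed.

Definition in_chart (i : chart_ix A) (u : M -> R) : E -> R^o := u \o inv i.

Definition diff_row (i : chart_ix A) (u : M -> R) (y : E) : E :=
  \row_a 'D_(e_ a) (in_chart i u) y.

(** The inner product of the differentials of [u] and [v] for the dual metric, which is also that of
    their gradients. *)
Definition cometric (i : chart_ix A) (u v : M -> R) (y : E) : R :=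
  (diff_row i u y *m invmx (gram g i y) *m (diff_row i v y)^T) 0 0.

Definition grad_inner (u v : M -> R) (x : M) : R := inner g x (grad g u x) (grad g v x).

Lemma gram_unit i y : im i y -> gram g i y \in unitmx.
Proof.
move=> iy; rewrite unitmxE unitfE; apply/negP => /det0P[v v0 vG].
by have := gram_pos g iy v0; rewrite vG mul0mx mxE ltxx.
Qed.

Lemma invmx_gram_sym i y : im i y -> (invmx (gram g i y))^T = invmx (gram g i y).
Proof. by move=> iy; rewrite trmx_inv gram_sym. Qed.

Lemma grad_inner_cometric_at u v x :
  grad_inner u v x = cometric (chart_at A x) u v (ch (chart_at A x) x).
Proof.
have iy := chart_imP (chart_at_dom A x).
rewrite /grad_inner /inner /grad /gram_at trmx_mul invmx_gram_sym// mulmxA.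
by rewrite (mulmxKV (gram_unit iy)).
Qed.

Lemma diff_row_change i j u x : dom i x -> dom j x ->
  differentiable (in_chart j u) (ch j x) ->
  diff_row i u (ch i x) =
  diff_row j u (ch j x) *m (jacobian (ch j \o inv i) (ch i x))^T.
Proof.
move=> ix jx du.
set T := ch j \o inv i; have Oy : (im i `&` inv i @^-1` (dom j)) (ch i x).
  by split; [exact: chart_imP|rewrite /= chart_invK].
have dT : differentiable T (ch i x) by exact: (chart_trans_Ck 1 i j).1.
have Ty : T (ch i x) = ch j x by rewrite /T /= chart_invK.
apply/rowP => a; rewrite mxE.
have -> : 'D_(e_ a) (in_chart i u) (ch i x) = 'D_(e_ a) (in_chart j u \o T) (ch i x).
  apply: near_eq_derive; near=> y; rewrite /in_chart /T /= chart_invK//.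
  suff : (im i `&` inv i @^-1` (dom j)) y by case.
  near: y; apply: open_nbhs_nbhs; split=> //.
  by apply: open_chart_preimage; exact: chart_dom_open.
have duT : differentiable (in_chart j u) (T (ch i x)) by rewrite Ty.
rewrite (derive_chain _ dT duT) mxE; apply: eq_bigr => b _; rewrite Ty !mxE mulrC.
by rewrite deriveEjacobian// -rowE !mxE.
Unshelve. all: by end_near. Qed.

(** In [G_i = J G_j J^T] the left-hand side is positive definite, hence invertible, and so is its
    factor [J]. *)
Lemma jacobian_unit i j x : dom i x -> dom j x ->
  jacobian (ch j \o inv i) (ch i x) \in unitmx.
Proof.
move=> ix jx; have := gram_unit (chart_imP ix).
by rewrite (gram_trans g ix jx)/= !unitmx_mul => /andP[/andP[]].
Qed.

(** Differentials are multiplied by [J^T], and [J^T (J G J^T)^-1 J = G^-1]. *)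
Lemma cometric_change i j u v x : dom i x -> dom j x ->
  differentiable (in_chart j u) (ch j x) ->
  differentiable (in_chart j v) (ch j x) ->
  cometric i u v (ch i x) = cometric j u v (ch j x).
Proof.
move=> ix jx du dv; rewrite /cometric (diff_row_change ix jx du) (diff_row_change ix jx dv).
rewrite (gram_trans g ix jx)/=; set J := jacobian _ _; set G := gram g j _.
have uJ : J \in unitmx by exact: jacobian_unit.
have uG : G \in unitmx by exact: gram_unit (chart_imP jx).
set P := J *m G *m J^T.
have uP : P \in unitmx by rewrite !unitmx_mul unitmx_tr uJ uG.
have JE : J^T = invmx G *m (invmx J *m P) by rewrite /P -mulmxA mulKmx// mulKmx.
have E : J^T *m invmx P *m J = invmx G.
  by rewrite JE -[_ *m invmx P]mulmxA mulmxK// -mulmxA mulVmx// mulmx1.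
by rewrite trmx_mul trmxK -!mulmxA (mulmxA J^T) (mulmxA _ J) E.
Qed.

(** [grad] at [x] is computed in [chart_at A x], which may jump from point to point. Reading the
    inner product in one fixed chart around a point is what gives access to its continuity. *)
Lemma grad_inner_cometric i u v x : dom i x -> Ck_mfd A 1 u -> Ck_mfd A 1 v ->
  grad_inner u v x = cometric i u v (ch i x).
Proof.
move=> ix Cu Cv; rewrite grad_inner_cometric_at; have jx := chart_at_dom A x.
apply: cometric_change => //.
  by apply: (Cu i).1; exact: chart_imP.
by apply: (Cv i).1; exact: chart_imP.
Qed.

Lemma continuous_cometric i u v : Ck_mfd A 1 u -> Ck_mfd A 1 v ->
  Ck_on 0 (im i) (cometric i u v : E -> R^o).
Proof.
move=> Cu Cv; have oi := @chart_im_open _ _ _ A i.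
have -> : cometric i u v = (fun y => \sum_b (\sum_a diff_row i u y 0 a *
    invmx (gram g i y) a b) * diff_row i v y 0 b).
  apply/funext => y; rewrite /cometric mxE; apply: eq_bigr => b _.
  by congr (_ * _); rewrite mxE.
have Hd w a : Ck_mfd A 1 w -> Ck_on 0 (im i) (fun y => diff_row i w y 0 a : R^o).
  move=> Cw; have -> : (fun y => diff_row i w y 0 a : R^o) = 'D_(e_ a) (in_chart i w).
    by apply/funext => y; rewrite mxE.
  exact: (Cw i).2.
apply: Ck_on_sum => // b; apply: Ck_onM => //; last exact: Hd.
apply: Ck_on_sum => // a; apply: Ck_onM => //; first exact: Hd.
apply: continuous_invmx => // [s t|]; last exact: gram_unit.
by apply: Ck_on_entry => //; exact: (gram_smooth g i 0).
Qed.

Lemma continuous_grad_inner u v : Ck_mfd A 1 u -> Ck_mfd A 1 v ->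
  continuous (grad_inner u v : M -> R^o).
Proof.
move=> Cu Cv x; set i := chart_at A x; have ix : dom i x := chart_at_dom A x.
have : {for x, continuous (cometric i u v \o ch i : M -> R^o)}.
  apply: continuous_comp; first exact: chart_cts.
  exact: Ck_on_continuous (continuous_cometric Cu Cv) (chart_imP ix).
rewrite /prop_for /continuous_at /= -grad_inner_cometric//; apply: cvg_trans.
apply: near_eq_cvg; near=> z; rewrite /= -grad_inner_cometric//.
by near: z; apply: open_nbhs_nbhs; split=> //; exact: chart_dom_open.
Unshelve. all: by end_near. Qed.

Lemma Ck_mfd_continuous k u : Ck_mfd A k u -> continuous (u : M -> R^o).
Proof.
move=> Cu x; set i := chart_at A x; have ix : dom i x := chart_at_dom A x.
have : {for x, continuous (in_chart i u \o ch i : M -> R^o)}.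
  apply: continuous_comp; first exact: chart_cts.
  exact: Ck_on_continuous (Cu i) (chart_imP ix).
rewrite /prop_for /continuous_at /= /in_chart /= chart_invK//; apply: cvg_trans.
apply: near_eq_cvg; near=> z; rewrite /= chart_invK//.
by near: z; apply: open_nbhs_nbhs; split=> //; exact: chart_dom_open.
Unshelve. all: by end_near. Qed.

End chart_calculus.

Lemma quad_form_addZ {R : comPzRingType} n (r s : 'rV[R]_n) (G : 'M[R]_n) t :
  ((r + t *: s) *m G *m (r + t *: s)^T) 0 0 =
  (r *m G *m r^T) 0 0 + t * (r *m G *m s^T) 0 0 +
  (t * (s *m G *m r^T) 0 0 + t ^+ 2 * (s *m G *m s^T) 0 0).
Proof.
rewrite linearD linearZ/= !mulmxDl !mulmxDr -!scalemxAl -!scalemxAr scalerA -expr2.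
move: (r *m G *m r^T) (r *m G *m s^T) (s *m G *m r^T) (s *m G *m s^T) => a b c d.
by rewrite !mxE !addrA [X in X + _]addrAC.
Qed.

Lemma discriminant_le {R : realFieldType} (a b c : R) : 0 <= a -> 0 <= c ->
  (forall t, 0 <= a + 2 * t * b + t ^+ 2 * c) -> b ^+ 2 <= a * c.
Proof.
move=> a0 c0 B0; have [cz|cn] := eqVneq c 0.
  have [->|bn] := eqVneq b 0; first by rewrite expr0n mulr_ge0.
  (* For [c = 0] the form is affine in [t], and at this [t] it equals [- 1]. *)
  have := B0 (- (a + 1) / (2 * b)); rewrite cz mulr0 addr0.
  have -> : 2 * (- (a + 1) / (2 * b)) * b = - (a + 1) by field.
  lra.
have cp : 0 < c by rewrite lt_def cn.
(* The minimum point of the form. *)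
have := B0 (- b / c).
have -> : a + 2 * (- b / c) * b + (- b / c) ^+ 2 * c = (a * c - b ^+ 2) / c by field.
by rewrite pmulr_lge0 ?invr_gt0// subr_ge0.
Qed.

Section manifold_calculus.
Context {R : realType} {m : nat} {M : ptopologicalType}.
Variables (A : smooth_atlas R m M) (g : riemannian_metric A).
Local Notation E := 'rV[R]_m.
Local Notation im i := (@chart_im R m M A i).
Local Notation ch i := (@chart R m M A i).
Local Notation inv i := (@chart_inv R m M A i).

Definition Ck_in (k : nat) (O : set M) (u : M -> R) : Prop :=
  forall i : chart_ix A, Ck_on k (im i `&` inv i @^-1` O) (in_chart i u).

Lemma Ck_mfd_in k O u : Ck_mfd A k u -> Ck_in k O u.
Proof. by move=> Cu i; apply: Ck_on_subset (Cu i) => y []. Qed.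

Lemma Ck_mfd_local k u :
  (forall x, exists O, O x /\ Ck_in k O u) -> Ck_mfd A k u.
Proof.
move=> H i; apply: Ck_on_local => y iy.
have [W [Wy CW]] := H (inv i y).
by exists (im i `&` inv i @^-1` W); split.
Qed.

Lemma Ck_in_ext k O u v : open O -> (forall x, O x -> u x = v x) ->
  Ck_in k O u -> Ck_in k O v.
Proof.
move=> oO uv Cu i; apply: Ck_on_ext (Cu i).
  exact: open_chart_preimage.
by move=> y [_ Oy]; exact: uv.
Qed.

Lemma Ck_in_cst k O c : Ck_in k O (fun=> c).
Proof. by move=> i; exact: Ck_on_cst. Qed.

Lemma Ck_inM k O u v : open O -> Ck_in k O u -> Ck_in k O v ->
  Ck_in k O (fun x => u x * v x).
Proof. by move=> oO Cu Cv i; apply: Ck_onM => //; exact: open_chart_preimage. Qed.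

Lemma C1_in_comp (O : set M) (s ds : R -> R) u : open O -> Ck_in 1 O u ->
  (forall x, O x -> is_derive (u x) 1 (s : R -> R^o) (ds (u x))) ->
  (forall x, O x -> {for (u x), continuous ds}) ->
  Ck_in 1 O (s \o u).
Proof.
move=> oO Cu Hs Hds i; apply: (Ck_on_comp1 (ds := ds) (F := in_chart i u)).
- exact: open_chart_preimage.
- exact: Cu.
- by move=> y [_ Oy]; exact: Hs.
- apply/Ck_on0P => y Oy; apply: continuous_comp.
    exact: Ck_on_continuous (Cu i) Oy.
  by apply: Hds; case: Oy.
Qed.

Lemma Ck_mfdD k u v : Ck_mfd A k u -> Ck_mfd A k v ->
  Ck_mfd A k (fun x => u x + v x).
Proof. by move=> Cu Cv i; apply: Ck_onD => //; exact: chart_im_open. Qed.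

Lemma Ck_mfdM k u v : Ck_mfd A k u -> Ck_mfd A k v ->
  Ck_mfd A k (fun x => u x * v x).
Proof. by move=> Cu Cv i; apply: Ck_onM => //; exact: chart_im_open. Qed.

Lemma Ck_mfdN k u : Ck_mfd A k u -> Ck_mfd A k (fun x => - u x).
Proof.
move=> Cu; have -> : (fun x => - u x) = (fun x => (- 1) * u x).
  by apply/funext => z; rewrite mulN1r.
by apply: Ck_mfdM => // i; exact: Ck_on_cst.
Qed.

Lemma Ck_mfd_sum k I (r : seq I) (u : I -> M -> R) :
  (forall i, Ck_mfd A k (u i)) -> Ck_mfd A k (fun x => \sum_(i <- r) u i x).
Proof. by move=> Cu i; apply: Ck_on_sum => // [|j]; [exact: chart_im_open|exact: Cu]. Qed.

Definition differentiable_mfd (u : M -> R) (x : M) : Prop :=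
  differentiable (in_chart (chart_at A x) u) (ch (chart_at A x) x).

Lemma Ck_in_differentiable O u x : Ck_in 1 O u -> O x -> differentiable_mfd u x.
Proof.
move=> Cu Ox; apply: (Cu _).1; have dx := chart_at_dom A x.
by split; [exact: chart_imP|rewrite /= chart_invK].
Qed.

Lemma Ck_mfd_differentiable u x : Ck_mfd A 1 u -> differentiable_mfd u x.
Proof. by move=> Cu; exact: (Ck_in_differentiable (Ck_mfd_in setT Cu)). Qed.

Definition diff_row_at (u : M -> R) (x : M) : E := diff_row (A := A) (chart_at A x) u (ch (chart_at A x) x).

Lemma grad_innerE u v x : grad_inner g u v x = (diff_row_at u x *m invmx (gram_at g x) *m (diff_row_at v x)^T) 0 0.
Proof. exact: grad_inner_cometric_at. Qed.

Lemma diff_row_at_near u v x : (\forall y \near x, u y = v y) -> diff_row_at u x = diff_row_at v x.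
Proof.
move=> uv; apply/rowP => a; rewrite !mxE; apply: near_eq_derive.
have dx := chart_at_dom A x.
have := chart_inv_cts (chart_imP dx); rewrite /prop_for /continuous_at chart_invK// => H.
exact: (H _ uv).
Qed.

Lemma diff_row_atD u v x : differentiable_mfd u x -> differentiable_mfd v x ->
  diff_row_at (fun y => u y + v y) x = diff_row_at u x + diff_row_at v x.
Proof.
move=> du dv; apply/rowP => a; rewrite !mxE.
by rewrite -deriveD//; exact: diff_derivable.
Qed.

Lemma diff_row_atM u v x : differentiable_mfd u x -> differentiable_mfd v x ->
  diff_row_at (fun y => u y * v y) x = u x *: diff_row_at v x + v x *: diff_row_at u x.
Proof.
move=> du dv; have dx := chart_at_dom A x.
have uE : in_chart (chart_at A x) u (ch (chart_at A x) x) = u x.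
  by rewrite /in_chart /= chart_invK.
have vE : in_chart (chart_at A x) v (ch (chart_at A x) x) = v x.
  by rewrite /in_chart /= chart_invK.
apply/rowP => a; rewrite !mxE -[in RHS]uE -[in RHS]vE.
by rewrite -deriveM//; exact: diff_derivable.
Qed.

Lemma diff_row_at_comp (s : R -> R) ds u x : differentiable_mfd u x ->
  is_derive (u x) 1 (s : R -> R^o) ds -> diff_row_at (s \o u) x = ds *: diff_row_at u x.
Proof.
move=> du Hs; have dx := chart_at_dom A x.
have uE : in_chart (chart_at A x) u (ch (chart_at A x) x) = u x.
  by rewrite /in_chart /= chart_invK.
have ds1 : differentiable (s : R^o -> R^o) (in_chart (chart_at A x) u (ch (chart_at A x) x)).
  by rewrite uE; apply/derivable1_diffP; have [] := Hs.
apply/rowP => a; rewrite !mxE.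
rewrite [LHS]deriveE; last exact: differentiable_comp du ds1.
rewrite (diff_comp du ds1) /= -[in LHS](deriveE _ du).
set d := 'D__ _ _; rewrite uE in ds1 *.
have -> : 'd (s : R^o -> R^o) (u x) d = d *: 'd (s : R^o -> R^o) (u x) 1.
  by rewrite -linearZ/= [d *: 1]mulr1.
by rewrite -deriveE// (@derive_val _ _ _ _ _ _ _ Hs) mulrC.
Qed.

Lemma invmx_gram_at_sym x : (invmx (gram_at g x))^T = invmx (gram_at g x).
Proof. exact: invmx_gram_sym (chart_imP (chart_at_dom A x)). Qed.

Lemma mx11_trE (B : 'M[R]_1) : B 0 0 = B^T 0 0.
Proof. by rewrite mxE. Qed.

Lemma grad_inner_sym u v x : grad_inner g u v x = grad_inner g v u x.
Proof.
by rewrite !grad_innerE [LHS]mx11_trE !trmx_mul trmxK invmx_gram_at_sym mulmxA.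
Qed.

Lemma grad_inner_near u v w x : (\forall y \near x, v y = w y) -> grad_inner g u v x = grad_inner g u w x.
Proof. by move=> vw; rewrite !grad_innerE (diff_row_at_near vw). Qed.

Lemma grad_innerDr u v w x : differentiable_mfd v x -> differentiable_mfd w x ->
  grad_inner g u (fun y => v y + w y) x = grad_inner g u v x + grad_inner g u w x.
Proof. by move=> dv dw; rewrite !grad_innerE diff_row_atD// linearD mulmxDr mxE. Qed.

Lemma grad_innerMr u v w x : differentiable_mfd v x -> differentiable_mfd w x ->
  grad_inner g u (fun y => v y * w y) x = v x * grad_inner g u w x + w x * grad_inner g u v x.
Proof.
by move=> dv dw; rewrite !grad_innerE diff_row_atM// linearD !linearZ mulmxDr -!scalemxAr !mxE.
Qed.

Lemma grad_inner_compr u v (s : R -> R) ds x : differentiable_mfd v x ->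
  is_derive (v x) 1 (s : R -> R^o) ds -> grad_inner g u (s \o v) x = ds * grad_inner g u v x.
Proof.
by move=> dv Hs; rewrite !grad_innerE (diff_row_at_comp dv Hs) linearZ -!scalemxAr mxE.
Qed.

Lemma grad_inner_compl u v (s : R -> R) ds x : differentiable_mfd v x ->
  is_derive (v x) 1 (s : R -> R^o) ds -> grad_inner g (s \o v) u x = ds * grad_inner g v u x.
Proof. by move=> dv Hs; rewrite grad_inner_sym (grad_inner_compr _ dv Hs) grad_inner_sym. Qed.

Lemma grad_normE u x : grad_norm g u x = Num.sqrt (grad_inner g u u x).
Proof. by []. Qed.

Lemma inner_p_field p u v x :
  inner g x (p_field g p u x) (grad g v x) = grad_norm g u x `^ (p - 2) * grad_inner g u v x.
Proof. by rewrite /inner /p_field -!scalemxAl mxE. Qed.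

Let inner_ge0 x (w : E) : 0 <= inner g x w w.
Proof.
have [->|w0] := eqVneq w 0; first by rewrite /inner !mul0mx mxE.
exact/ltW/(gram_pos g (chart_imP (chart_at_dom A x))).
Qed.

Lemma grad_inner_ge0 u x : 0 <= grad_inner g u u x. Proof. exact: inner_ge0. Qed.

Lemma sqr_grad_norm u x : grad_norm g u x ^+ 2 = grad_inner g u u x.
Proof. by rewrite grad_normE sqr_sqrtr// grad_inner_ge0. Qed.

(** The quadratic form [|grad u + t grad v| ^ 2] is nonnegative in [t], which bounds its
    discriminant. *)
Lemma grad_inner_CauchySchwarz u v x : `|grad_inner g u v x| <= grad_norm g u x * grad_norm g v x.
Proof.
have B0 t : 0 <= grad_inner g u u x + 2 * t * grad_inner g u v x + t ^+ 2 * grad_inner g v v x.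
  have E : inner g x (grad g u x + t *: grad g v x) (grad g u x + t *: grad g v x) =
      grad_inner g u u x + t * grad_inner g u v x +
      (t * grad_inner g v u x + t ^+ 2 * grad_inner g v v x).
    exact: quad_form_addZ.
  have := inner_ge0 x (grad g u x + t *: grad g v x); rewrite E (grad_inner_sym v u).
  move: (grad_inner g u u x) (grad_inner g u v x) (grad_inner g v v x) => a b c.
  by rewrite (_ : a + 2 * t * b + t ^+ 2 * c = a + t * b + (t * b + t ^+ 2 * c)) //; ring.
have bac := discriminant_le (grad_inner_ge0 u x) (grad_inner_ge0 v x) B0.
rewrite !grad_normE -(sqrtrM _ (grad_inner_ge0 u x)) -sqrtr_sqr.
exact: ler_wsqrtr bac.
Qed.

Lemma continuous_grad_norm u : Ck_mfd A 1 u -> continuous (grad_norm g u : M -> R^o).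
Proof.
move=> Cu x; apply: (@continuous_comp _ _ _ (grad_inner g u u) Num.sqrt).
  exact: continuous_grad_inner.
exact: sqrt_continuous.
Qed.

End manifold_calculus.

(** * Bumps supported in coordinate simplices *)

Section simplex_bump.
Context {R : realType} {m : nat} {M : ptopologicalType}.
Variables (A : smooth_atlas R m M).
Hypothesis M_hausdorff : hausdorff_space M.
Local Notation E := 'rV[R]_m.
Local Notation dom i := (@chart_dom R m M A i).
Local Notation im i := (@chart_im R m M A i).
Local Notation ch i := (@chart R m M A i).
Local Notation inv i := (@chart_inv R m M A i).

Definition extend (i : chart_ix A) (F : E -> R) (x : M) : R :=
  if pselect (dom i x) then F (ch i x) else 0.

Lemma extend_dom i F x : dom i x -> extend i F x = F (ch i x).
Proof. by rewrite /extend; case: pselect. Qed.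

Lemma extend_ndom i F x : ~ dom i x -> extend i F x = 0.
Proof. by rewrite /extend; case: pselect. Qed.

(** A product over all [m + 1] barycentric coordinates, so that for [lam > 0] it is positive exactly
    in the interior of the simplex. *)
Definition bump_rV (c : E) (lam : R) (y : E) : R :=
  \prod_a bump 1 (bary c lam a y) * bump 1 (bary0 c lam y).

Lemma Ck_on_bump_rV k c lam (U : set E) : open U ->
  Ck_on k U (bump_rV c lam : E -> R^o).
Proof.
move=> oU; apply: Ck_onM => //.
  apply: Ck_on_prod => // a; apply: (@Ck_on_bump R m k U 1 (bary c lam a)) => //.
  exact: Ck_on_bary.
by apply: (@Ck_on_bump R m k U 1 (bary0 c lam)) => //; exact: Ck_on_bary0.
Qed.

Lemma bump_rV_ge0 c lam y : 0 <= bump_rV c lam y.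
Proof. by rewrite mulr_ge0 ?bump_ge0// prodr_ge0// => a _; exact: bump_ge0. Qed.

Lemma bump_rV_gt0 c lam y : (forall a, 0 < bary c lam a y) -> 0 < bary0 c lam y ->
  0 < bump_rV c lam y.
Proof.
by move=> b0 b1; rewrite mulr_gt0 ?bump_gt0// prodr_gt0// => a _; rewrite bump_gt0.
Qed.

Lemma bump_rV_out c lam y : 0 < lam -> ~ simplex c lam y -> bump_rV c lam y = 0.
Proof.
move=> lam0 yn; apply: contrapT => /eqP.
rewrite mulf_eq0 negb_or => /andP[/prodf_neq0 pa p0].
have pos t : bump 1 t != 0 -> 0 < t :> R by rewrite -bump_gt0 lt_def bump_ge0 andbT.
apply: yn; split=> [a|].
  by have /pos := pa a isT; rewrite /bary pmulr_lgt0 ?invr_gt0// subr_gt0 => /ltW.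
by have /pos := p0; rewrite subr_gt0 -mulr_suml ltr_pdivrMr// mul1r => /ltW.
Qed.

Variables (i : chart_ix A) (c : E) (lam : R).
Hypotheses (lam0 : 0 < lam) (sub : simplex c lam `<=` im i).

Definition patch_set : set M := inv i @` simplex c lam.

Lemma patch_set_dom : patch_set `<=` dom i.
Proof. by move=> _ [y ys <-]; apply: chart_inv_dom; exact: sub. Qed.

Lemma patch_setP x : dom i x -> patch_set x <-> simplex c lam (ch i x).
Proof.
move=> dx; split=> [[y ys <-]|xs]; last by exists (ch i x) => //; rewrite chart_invK.
by rewrite chartVK//; exact: sub.
Qed.

Lemma compact_patch_set : compact patch_set.
Proof.
apply: continuous_compact; last exact: simplex_compact.
apply: continuous_in_subspaceT => y /set_mem ys.
by apply: chart_inv_cts; exact: sub.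
Qed.

Lemma closed_patch_set : closed patch_set.
Proof. exact: compact_closed M_hausdorff compact_patch_set. Qed.

Lemma extend_out F x : (forall y, ~ simplex c lam y -> F y = 0) -> ~ patch_set x ->
  extend i F x = 0.
Proof.
move=> F0 xn; rewrite /extend; case: pselect => // dx; apply: F0.
by move/(patch_setP dx).
Qed.

(** Two open sets cover [M]: the domain of [i], where the function is [F] read through transition
    maps, and the complement of the patch, where it is 0. The latter is open because a compact
    subset of a Hausdorff space is closed. *)
Lemma extend_Ck k (F : E -> R^o) : (forall y, ~ simplex c lam y -> F y = 0) ->
  Ck_on k (im i) F -> Ck_mfd A k (extend i F).
Proof.
move=> F0 CF; apply: Ck_mfd_local => x.
have [dx|dx] := pselect (dom i x); last first.
  exists (~` patch_set); split; first by move/patch_set_dom.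
  have oD : open (~` patch_set) by rewrite openC; exact: closed_patch_set.
  apply: (Ck_in_ext oD _ (Ck_in_cst (A := A) k (~` patch_set) 0)) => z zn.
  by rewrite extend_out.
exists (dom i); split=> // j.
have oW : open (im j `&` inv j @^-1` dom i) by apply: open_chart_preimage; exact: chart_dom_open.
have CT : Ck_on k (im j `&` inv j @^-1` dom i) (F \o (ch i \o inv j)).
  apply: (Ck_on_comp oW (@chart_im_open _ _ _ A i)) => //; last exact: chart_trans_Ck.
  by move=> y [_ yi]; exact: chart_imP.
apply: (Ck_on_ext oW _ CT) => y [_ yi].
by rewrite /in_chart /= extend_dom.
Qed.

End simplex_bump.

Lemma exists_simplex {R : realType} {m : nat} (U : set 'rV[R]_m) (y : 'rV[R]_m) :
  open U -> U y -> exists c lam, [/\ 0 < lam, simplex c lam `<=` U &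
    0 < bump_rV c lam y].
Proof.
move=> oU Uy.
have [r /= r0 rU] : nbhs_ball y U by apply/nbhs_ballP; exact: open_nbhs_nbhs.
(* The size [r / 2] keeps the simplex in the ball of radius [r] for the maximum norm, and [d] is
   chosen to make [y] the barycentre: all its [m + 1] barycentric coordinates are [1 / m.+1]. *)
pose lam := r / 2; have lam0 : 0 < lam by rewrite divr_gt0.
pose d := lam / m.+1%:R; have d0 : 0 < d by rewrite divr_gt0.
pose c : 'rV[R]_m := y - const_mx d.
have cE a : c 0 a = y 0 a - d by rewrite !mxE.
have dl : d <= lam by rewrite ler_pdivrMr// ler_peMr ?ler1n// ltW.
exists c, lam; split => // [z [zc zs]|].
  apply: rU; split=> // i a; rewrite ord1.
  have z1 : z 0 a - c 0 a <= lam.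
    rewrite (le_trans _ zs)// (bigD1 a)//= lerDl sumr_ge0// => b _.
    by rewrite subr_ge0.
  have rl : lam < r by rewrite ltr_pdivrMr// ltr_pMr// ltr1n.
  rewrite /ball/= ltr_norml; move: (zc a) z1; rewrite cE => z0 z1.
  apply/andP; split; lra.
have bE a : bary c lam a y = (m.+1%:R)^-1.
  rewrite /bary cE opprB addrC subrK /d mulrAC divff ?mul1r//.
  by rewrite gt_eqF.
apply: bump_rV_gt0 => [a|]; first by rewrite bE invr_gt0.
rewrite /bary0; under eq_bigr do rewrite bE.
rewrite sumr_const card_ord subr_gt0 -[_^-1 *+ m]mulr_natl ltr_pdivrMr// mul1r.
by rewrite ltr_nat.
Qed.

(** * Volume of compact sets *)

(* No measurability is needed, as the integral of a nonnegative function is a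
   supremum over the simple functions below it. *)
Lemma ge0_le_integralT d (T : measurableType d) (R : realType)
    (mu : {measure set T -> \bar R}) (f1 f2 : T -> \bar R) :
  (forall x, 0 <= f1 x)%E -> (forall x, f1 x <= f2 x)%E ->
  (\int[mu]_x f1 x <= \int[mu]_x f2 x)%E.
Proof.
move=> f10 f12; rewrite !ge0_integralTE//; last first.
  by move=> x; exact: le_trans (f12 x).
apply: le_ereal_sup => _ [h hf <-]; exists h => // x.
exact: le_trans (hf x) (f12 x).
Qed.

Lemma lebesgue_integral_rV_ge0 {R : realType} n (h : 'rV[R]_n -> \bar R) :
  (forall v, 0 <= h v)%E -> (0 <= lebesgue_integral_rV h)%E.
Proof.
elim: n h => [|n IH] h h0 /=; first exact: h0.
by apply: integral_ge0 => t _; apply: IH.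
Qed.

(** Induction on the dimension: the slice at [t] is bounded by the case [n] when [t] lies in the
    first edge of the box and vanishes otherwise, so its integral is dominated by a multiple of an
    indicator. *)
Lemma lebesgue_integral_rV_box {R : realType} n (c : 'rV[R]_n) (L C : R)
    (h : 'rV[R]_n -> \bar R) :
  0 <= L -> 0 <= C -> (forall v, 0 <= h v)%E ->
  (forall v, h v <= C%:E)%E ->
  (forall v : 'rV[R]_n, ~ (forall a, c 0 a <= v 0 a <= c 0 a + L) -> h v = 0%E) ->
  (lebesgue_integral_rV h <= (C * L ^+ n)%:E)%E.
Proof.
move=> L0; elim: n c C h => [|n IH] c C h C0 h0 hC hout /=.
  by rewrite expr0 mulr1.
pose c0 : R := c 0 ord0; pose c' : 'rV[R]_n := \row_a c 0 (lift ord0 a).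
have E0 t (v : 'rV[R]_n) : (row_mx (t%:M : 'rV[R]_1) v : 'rV[R]_(1 + n)) 0 ord0 = t.
  have -> : ord0 = lshift n (ord0 : 'I_1) by exact: val_inj.
  by rewrite row_mxEl mxE eqxx.
have ES t (v : 'rV[R]_n) a : (row_mx (t%:M : 'rV[R]_1) v : 'rV[R]_(1 + n)) 0 (lift ord0 a) = v 0 a.
  have -> : lift ord0 a = rshift 1 a by exact: val_inj.
  by rewrite row_mxEr.
apply: (@le_trans _ _ (\int[@lebesgue_measure R]_t
    ((C * L ^+ n)%:E * (\1_(`[c0, c0 + L]) t)%:E))%E).
  apply: ge0_le_integralT => t; first exact: lebesgue_integral_rV_ge0.
  rewrite indicE; have [tI|tI] := boolP (t \in _).
    rewrite mule1; apply: (IH c') => // v vout; apply: hout => vbox; apply: vout => a.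
    by have := vbox (lift ord0 a); rewrite ES mxE.
  have ht v : h (row_mx (t%:M : 'rV[R]_1) v : 'rV[R]_(1 + n)) = 0%E.
    apply: hout => vbox; move/negP: tI; apply; rewrite inE/= in_itv/=.
    by have := vbox ord0; rewrite E0.
  (* The slice vanishes here, so the induction hypothesis applies with the bound 0. *)
  rewrite mule0; have := IH c' 0 (fun v => h (row_mx (t%:M : 'rV[R]_1) v : 'rV[R]_(1 + n))).
  rewrite mul0r; apply => //.
  by move=> v; rewrite ht.
rewrite ge0_integralZl//; last 2 first.
- by apply/measurable_EFinP; exact: measurable_indic.
- by rewrite lee_fin mulr_ge0// exprn_ge0.
rewrite integral_indic// setIT.
have E : (@lebesgue_measure R) `[c0, (c0 + L)%R]%classic = L%:E.
  apply: etrans (lebesgue_measure_itv `[c0, (c0 + L)%R]) _.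
  rewrite /= lte_fin ltrDl -EFinB [c0 + L]addrC addrK.
  by case: ltgtP L0 => // <-.
refine (eq_ind_r (fun z => ((C * L ^+ n)%:E * z <= (C * L ^+ n.+1)%:E)%E) _ E).
by rewrite -EFinM lee_fin exprSr mulrA.
Qed.

Lemma closed_borel (M : ptopologicalType) (D : set M) :
  closed D -> measurable (D : set (borel M)).
Proof.
move=> cD; rewrite -[D]setCK; apply: measurableC; apply: sub_sigma_algebra.
by rewrite /= openC.
Qed.

Lemma continuous_borel_measurable {R : realType} (M : ptopologicalType) (f : M -> R) :
  continuous f -> measurable_fun setT (f : borel M -> R).
Proof.
move=> /continuousP cf; apply: (measurability _ (RGenOpens.measurableE R)).
move=> _ [_ [a [b ->] <-]]; rewrite setTI; apply: sub_sigma_algebra.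
by apply: cf; exact: interval_open.
Qed.

Lemma continuous_compact_bounded {R : realType} (T : topologicalType) (f : T -> R) (K : set T) :
  compact K -> (forall x, K x -> {for x, continuous f}) ->
  exists2 C, 0 <= C & forall x, K x -> `|f x| <= C.
Proof.
move=> cK cf.
have cf' : {within K, continuous (f : T -> R^o)}.
  by apply: continuous_in_subspaceT => y /set_mem; exact: cf.
have [B [Br HB]] := compact_bounded (continuous_compact cf' cK).
exists (`|B| + 1); first by rewrite addr_ge0.
move=> y Ky; apply: HB; last by exists y.
by rewrite (le_lt_trans (ler_norm _))// ltrDl.
Qed.

Section compact_volume.
Context {R : realType} {m : nat} {M : ptopologicalType}.
Variables (A : smooth_atlas R m M) (g : riemannian_metric A).
Variable vol : {measure set (borel M) -> \bar R}.
Hypothesis M_hausdorff : hausdorff_space M.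
Hypothesis vol_riemannian : is_riemannian_measure g vol.
Local Notation E := 'rV[R]_m.
Local Notation im i := (@chart_im R m M A i).
Local Notation ch i := (@chart R m M A i).

(** The density [sqrt (det g)] is bounded on the compact simplex, and the image of the patch lies in
    a cube of side [lam]. *)
Lemma patch_set_finite_volume i c (lam : R) : 0 < lam -> simplex c lam `<=` im i ->
  (vol (patch_set i c lam) < +oo)%E.
Proof.
move=> lam0 sub.
have mD := closed_borel (closed_patch_set M_hausdorff sub).
rewrite (vol_riemannian mD (patch_set_dom sub)).
have cdet : Ck_on 0 (im i) (fun y => \det (gram g i y) : R^o).
  apply: Ck_on_det => [|a b]; first exact: chart_im_open.
  by apply: Ck_on_entry; [exact: chart_im_open|exact: (gram_smooth g i 0)].
have [C C0 HC] : exists2 C, 0 <= C & forall y, simplex c lam y ->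
    `|Num.sqrt (\det (gram g i y))| <= C.
  apply: continuous_compact_bounded; first exact: simplex_compact.
  move=> y /sub iy; apply: (@continuous_comp _ _ _ (fun y => \det (gram g i y)) Num.sqrt).
    exact: Ck_on_continuous cdet iy.
  exact: sqrt_continuous.
have imE y : (ch i @` patch_set i c lam) y -> simplex c lam y.
  move=> [x xD <-]; have dx := patch_set_dom sub xD.
  by move: xD; move/(patch_setP sub dx).
apply: (@le_lt_trans _ _ (C * lam ^+ m)%:E); last exact: ltry.
apply: (lebesgue_integral_rV_box (c := c)) => //.
- exact: ltW.
- move=> v; rewrite lee_fin indicE; have [/set_mem vD|vD] := boolP (v \in _).
    by rewrite mul1r (le_trans (ler_norm _))// HC//; exact: imE.
  by rewrite mul0r.
- move=> v vout; rewrite indicE; have [/set_mem vD|vD] := boolP (v \in _).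
    exfalso; apply: vout => a; have [vc vs] := imE _ vD.
    rewrite vc/= -lerBlDl (le_trans _ vs)// (bigD1 a)//= lerDl sumr_ge0// => b _.
    by rewrite subr_ge0.
  by rewrite mul0r.
Qed.

End compact_volume.

(** * Smooth approximation of C^1 functions on a patch *)

Section patch_approximation.
Context {R : realType} {m : nat} {M : ptopologicalType}.
Variables (A : smooth_atlas R m M) (g : riemannian_metric A).
Hypothesis M_hausdorff : hausdorff_space M.
Local Notation E := 'rV[R]_m.
Local Notation e_ a := (delta_mx 0 a : 'rV[R]_m).
Local Notation dom i := (@chart_dom R m M A i).
Local Notation im i := (@chart_im R m M A i).
Local Notation ch i := (@chart R m M A i).
Variables (i : chart_ix A) (c : E) (lam : R).
Hypotheses (lam0 : 0 < lam) (sub : simplex c lam `<=` im i).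
Local Notation K := (simplex c lam).

Definition patch_bump : M -> R := extend i (bump_rV c lam).

Lemma patch_bump_ge0 x : 0 <= patch_bump x.
Proof.
have [dx|dx] := pselect (dom i x); last by rewrite /patch_bump extend_ndom.
by rewrite /patch_bump extend_dom// bump_rV_ge0.
Qed.

Lemma patch_bump_out x : ~ patch_set i c lam x -> patch_bump x = 0.
Proof. by apply: (extend_out sub) => y yn; exact: bump_rV_out. Qed.

Lemma smooth_patch_bump : smooth_mfd A patch_bump.
Proof.
move=> k; apply: (extend_Ck M_hausdorff sub) => [y|]; first exact: bump_rV_out.
by apply: Ck_on_bump_rV; exact: chart_im_open.
Qed.

Lemma simplex_bounded (f : E -> R) : Ck_on 0 (im i) (f : E -> R^o) ->
  exists2 C, 0 <= C & forall y, K y -> `|f y| <= C.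
Proof.
move=> Cf; apply: continuous_compact_bounded; first exact: simplex_compact.
by move=> y /sub iy; exact: Ck_on_continuous Cf iy.
Qed.

Lemma simplex_bounded_fin (I : finType) (f : I -> E -> R) :
  (forall a, Ck_on 0 (im i) (f a : E -> R^o)) ->
  exists2 C, 0 <= C & forall a y, K y -> `|f a y| <= C.
Proof.
move=> Cf; have /choice[B HB] : forall a, exists C, 0 <= C /\ forall y, K y -> `|f a y| <= C.
  by move=> a; have [C C0 HC] := simplex_bounded (Cf a); exists C.
exists (\sum_a B a); first by apply: sumr_ge0 => a _; exact: (HB a).1.
move=> a y Ky; rewrite (le_trans ((HB a).2 y Ky))// (bigD1 a)//= lerDl.
by apply: sumr_ge0 => b _; exact: (HB b).1.
Qed.

(** The inverse Gram matrix has bounded entries on the compact simplex; this converts bounds on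
    partial derivatives into a bound on the gradient. *)
Lemma cometric_bound : exists2 C, 0 <= C & forall (e : M -> R) y d, K y -> 0 <= d ->
  (forall a, `|'D_(e_ a) (in_chart i e) y| <= d) -> cometric g i e e y <= C * d ^+ 2.
Proof.
have [C C0 HC] : exists2 C, 0 <= C & forall (ab : 'I_m * 'I_m) y, K y ->
    `|invmx (gram g i y) ab.1 ab.2| <= C.
  apply: simplex_bounded_fin => ab; apply: continuous_invmx; first exact: chart_im_open.
    move=> s t; apply: Ck_on_entry; first exact: chart_im_open.
    exact: (gram_smooth g i 0).
  by move=> y iy; exact: gram_unit.
exists (\sum_(b < m) \sum_(a < m) C).
  by apply: sumr_ge0 => b _; apply: sumr_ge0.
move=> e y d Ky d0 He; rewrite /cometric mxE mulr_suml; apply: ler_sum => b _.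
rewrite mxE !mulr_suml; apply: ler_sum => a _.
rewrite (le_trans (ler_norm _))// !normrM.
have -> : C * d ^+ 2 = d * C * d by ring.
apply: ler_pM; rewrite ?mulr_ge0//; last by rewrite mxE mxE; exact: He.
by apply: ler_pM => //; [rewrite mxE; exact: He|exact: (HC (a, b))].
Qed.

(* The error is [patch_bump * (bernstein n q - q)]. *)
Lemma approx_patch (q : M -> R) (d : R) : Ck_mfd A 1 q -> (forall x, 0 <= q x) -> 0 < d ->
  exists w, [/\ smooth_mfd A w, forall x, 0 <= w x,
    forall x, ~ patch_set i c lam x -> w x = 0 &
    forall x, patch_set i c lam x -> `|w x - patch_bump x * q x| <= d /\
      grad_norm g (fun y => w y - patch_bump y * q y) x <= d].
Proof.
move=> Cq q0 d0.
have oi := @chart_im_open _ _ _ A i.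
pose b := bump_rV c lam; pose B := bernstein c lam (in_chart i q).
have Cb k : Ck_on k (im i) (b : E -> R^o) by exact: Ck_on_bump_rV.
have [C1 C10 HC1] := simplex_bounded (Cb 0).
have [C2 C20 HC2] := simplex_bounded_fin (fun a => (Cb 1).2 a).
have [C3 C30 HC3] := cometric_bound.
(* With errors at most [t] for [q] and its partial derivatives, the total error is at most [C1 t],
   its partial derivatives at most [(C1 + C2) t], and its gradient at most [sqrt C3 (C1 + C2) t].
   The 1 makes [D] positive. *)
pose D := 1 + C1 + Num.sqrt C3 * (C1 + C2).
have D0 : 0 < D by rewrite /D -addrA ltr_pwDl// addr_ge0// mulr_ge0 ?sqrtr_ge0 ?addr_ge0.
pose t := d / D; have t0 : 0 < t by rewrite divr_gt0.
have [n Hn1 Hn2] : exists2 n, (forall y, K y -> `|B n y - in_chart i q y| <= t) &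
    (forall a y, K y -> `|'D_(e_ a) (B n : E -> R^o) y - 'D_(e_ a) (in_chart i q) y| <= t).
  have H1 := bernstein_cvg lam0 sub (Cq i) t0.
  have H2 := filter_forall _ (fun a => derive_bernstein_cvg lam0 sub (Cq i) a t0).
  have [n0 _ /(_ n0 (leqnn _))[h1 h2]] := filterI H1 (H2 _).
  by exists n0.
pose F y := b y * B n y.
have F0 y : ~ K y -> F y = 0 by move=> Ky; rewrite /F /b bump_rV_out ?mul0r.
have CB k : Ck_on k (im i) (B n : E -> R^o) by exact: Ck_on_walk.
have CF k : Ck_on k (im i) (F : E -> R^o) by apply: Ck_onM.
exists (extend i F); split.
- by move=> k; exact: (extend_Ck M_hausdorff sub F0 (CF k)).
- move=> x; have [dx|dx] := pselect (dom i x); last by rewrite extend_ndom.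
  rewrite extend_dom//.
  have [Kx|Kx] := pselect (K (ch i x)); last by rewrite F0.
  rewrite mulr_ge0 ?bump_rV_ge0//; apply: bernstein_ge0 => // z _; exact: q0.
- by move=> x; exact: (extend_out sub F0).
move=> x Dx; have dx := patch_set_dom sub Dx; have Kx := (patch_setP sub dx).1 Dx.
have ix := chart_imP dx.
set e := (fun y => _ - _ : R).
pose G y := b y * (B n y - in_chart i q y).
have eG : forall y, im i y -> in_chart i e y = G y.
  move=> y iy; rewrite /in_chart /e /=.
  rewrite /patch_bump !extend_dom; [|exact: chart_inv_dom..].
  by rewrite !chartVK// /F /G /in_chart /= mulrBr.
have bG y : K y -> `|G y| <= C1 * t.
  by move=> Ky; rewrite /G normrM ler_pM// ?HC1// Hn1.
have dG a : `|'D_(e_ a) (in_chart i e) (ch i x)| <= (C1 + C2) * t.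
  have -> : 'D_(e_ a) (in_chart i e) (ch i x) = 'D_(e_ a) (G : E -> R^o) (ch i x).
    apply: near_eq_derive; near=> y; apply: eG.
    by near: y; exact: open_nbhs_nbhs.
  have d1 : derivable (b : E -> R^o) (ch i x) (e_ a).
    by apply: diff_derivable; exact: (Cb 1).1.
  have d2 : derivable (B n : E -> R^o) (ch i x) (e_ a).
    by apply: diff_derivable; exact: (CB 1).1.
  have d3 : derivable (in_chart i q) (ch i x) (e_ a).
    by apply: diff_derivable; exact: (Cq i).1.
  have d4 : derivable ((B n : E -> R^o) - in_chart i q) (ch i x) (e_ a).
    exact: derivableB.
  rewrite [X in `|X| <= _](deriveM d1 d4) (deriveB d2 d3).
  rewrite (le_trans (ler_normD _ _))// mulrDl lerD// normrM.
    by rewrite ler_pM// ?HC1// Hn2.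
  rewrite mulrC ler_pM//; first exact: HC2.
  exact: Hn1.
have Dt : D * t = d by rewrite /t mulrC divfK// gt_eqF.
split.
  have -> : extend i F x - patch_bump x * q x = G (ch i x).
    by rewrite -eG// /in_chart /= chart_invK.
  rewrite (le_trans (bG _ Kx))// -Dt ler_wpM2r ?(ltW t0)// /D.
  by rewrite addrAC lerDr addr_ge0// mulr_ge0 ?sqrtr_ge0 ?addr_ge0.
have Ce : Ck_mfd A 1 e.
  apply: Ck_mfdD; first exact: (extend_Ck M_hausdorff sub F0 (CF 1)).
  exact: (Ck_mfdN (Ck_mfdM (smooth_patch_bump 1%N) Cq)).
rewrite grad_normE (grad_inner_cometric _ dx)//.
have Ct : 0 <= (C1 + C2) * t by rewrite mulr_ge0 ?addr_ge0// ltW.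
rewrite (le_trans (ler_wsqrtr (HC3 _ _ _ Kx Ct dG)))//.
rewrite sqrtrM// sqrtr_sqr ger0_norm// mulrA -Dt ler_wpM2r ?(ltW t0)//.
by rewrite /D lerDr addr_ge0.
Unshelve. all: by end_near. Qed.

End patch_approximation.

(** For [r > 0] the zeros of [f] are treated directly, since the derivative of the power is used at
    positive points only. For [r = 0] the power is 1 everywhere, even at 0; this case occurs when
    [chi = p - 1]. *)
Lemma continuous_powR_nneg {R : realType} (T : topologicalType) (f : T -> R) (r : R) :
  0 <= r -> (forall x, 0 <= f x) -> continuous (f : T -> R^o) ->
  continuous (fun x => f x `^ r : R^o).
Proof.
rewrite le_eqVlt => /predU1P[<-|r0] f0 cf x.
  by under eq_fun do rewrite powRr0; exact: cst_continuous.
have := f0 x; rewrite le_eqVlt => /predU1P[fx0|fx0]; last first.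
  apply: (@continuous_comp _ _ _ f (fun t => t `^ r)); first exact: cf.
  apply: (@differentiable_continuous _ R^o R^o); apply/derivable1_diffP.
  by have [] := is_derive1_powR r fx0.
rewrite /prop_for /continuous_at -fx0 powR0 ?gt_eqF//.
apply/cvgrPdist_lt => e e0.
have er0 : 0 < e `^ r^-1 by exact: powR_gt0.
have /cvgrPdist_lt/(_ _ er0) := cf x; rewrite -fx0; apply: filterS => y.
rewrite !sub0r !normrN ger0_norm// ger0_norm ?powR_ge0// => fy.
have -> : e = (e `^ r^-1) `^ r by rewrite -powRrM mulVf ?gt_eqF// powRr1// ltW.
by apply: gt0_ltr_powR => //; rewrite nnegrE// powR_ge0.
Qed.

(** * Finite covers by patches *)

Lemma compact_finite_cover (T : ptopologicalType) (K : set T) (O : T -> set T) :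
  compact K -> (forall x, open (O x)) -> (forall x, O x x) ->
  exists s : seq T, forall x, K x -> exists2 z, z \in s & O z x.
Proof.
move=> + oO Oxx; rewrite compact_cover => cK.
have [|D _ HD] := cK T setT O (fun x _ => oO x); first by move=> x _; exists x.
by exists (finmap.enum_fset D) => x /HD[z zD Ozx]; exists z.
Qed.

Section weak_inequality.
Context {R : realType} {m : nat} {M : ptopologicalType}.
Variables (A : smooth_atlas R m M) (g : riemannian_metric A).
Variable vol : {measure set (borel M) -> \bar R}.
Hypothesis M_hausdorff : hausdorff_space M.
Hypothesis vol_riemannian : is_riemannian_measure g vol.
Local Notation E := 'rV[R]_m.
Local Notation im i := (@chart_im R m M A i).

Lemma patch_family : exists (c : M -> E) (lam : M -> R), forall x,
  [/\ 0 < lam x, simplex (c x) (lam x) `<=` im (chart_at A x) &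
      0 < patch_bump (chart_at A x) (c x) (lam x) x].
Proof.
have /choice[f Hf] : forall x, exists cl : E * R, [/\ 0 < cl.2,
    simplex cl.1 cl.2 `<=` im (chart_at A x) &
    0 < patch_bump (chart_at A x) cl.1 cl.2 x].
  move=> x; have dx := chart_at_dom A x.
  have [c [lam [l0 sub b0]]] :=
    exists_simplex (@chart_im_open _ _ _ A (chart_at A x)) (chart_imP dx).
  by exists (c, lam); split; rewrite // /patch_bump extend_dom.
by exists (fun x => (f x).1), (fun x => (f x).2).
Qed.

Lemma patch_finite_cover (c : M -> E) (lam : M -> R) (K : set M) :
  (forall x, [/\ 0 < lam x, simplex (c x) (lam x) `<=` im (chart_at A x) &
      0 < patch_bump (chart_at A x) (c x) (lam x) x]) -> compact K ->
  exists s : seq M, forall x, K x ->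
    exists2 z, z \in s & 0 < patch_bump (chart_at A z) (c z) (lam z) x.
Proof.
move=> Hcl cK; apply: (compact_finite_cover
  (O := fun z => [set x | 0 < patch_bump (chart_at A z) (c z) (lam z) x]) cK) => x.
  have [l0 sub _] := Hcl x.
  have /continuousP cb := Ck_mfd_continuous (smooth_patch_bump M_hausdorff l0 sub 0).
  exact: (cb _ (@open_gt R 0)).
by have [] := Hcl x.
Qed.

Lemma compact_finite_volume (K : set M) : compact K -> (vol K < +oo)%E.
Proof.
move=> cK; have [c [lam Hcl]] := patch_family.
have [s Hs] := patch_finite_cover Hcl cK.
pose D x : set (borel M) := patch_set (chart_at A x) (c x) (lam x).
have mD x : measurable (D x).
  by have [l0 sub _] := Hcl x; apply: closed_borel; exact: closed_patch_set.
have mU : measurable (\big[setU/set0]_(x <- s) D x).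
  by apply: bigsetU_measurable => x _.
have KU : K `<=` \big[setU/set0]_(x <- s) D x.
  move=> x /Hs[z zs] /= b0; rewrite -bigcup_seq; exists z => //=.
  have [l0 sub _] := Hcl z; apply: contrapT => zn.
  by move: b0; rewrite patch_bump_out// ltxx.
have mK := closed_borel (compact_closed M_hausdorff cK).
apply: (@le_lt_trans _ _ (vol (\big[setU/set0]_(x <- s) D x))).
  by apply: le_measure => //; rewrite inE.
elim: s {Hs mU KU} => [|x s IH]; first by rewrite big_nil measure0.
rewrite big_cons; apply: (@le_lt_trans _ _
    (vol (D x) + vol (\big[setU/set0]_(y <- s) D y))%E).
  by apply: measureU2 => //; apply: bigsetU_measurable => y _.
have [l0 sub _] := Hcl x.
apply: lte_add_pinfty; last exact: IH.
exact: (patch_set_finite_volume M_hausdorff vol_riemannian l0 sub).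
Qed.

End weak_inequality.

(** * Testing the weak inequality with C^1 functions *)

Section flux.
Context {R : realType} {m : nat} {M : ptopologicalType}.
Variables (A : smooth_atlas R m M) (g : riemannian_metric A).
Variable vol : {measure set (borel M) -> \bar R}.
Hypothesis M_hausdorff : hausdorff_space M.
Hypothesis vol_riemannian : is_riemannian_measure g vol.

Lemma integrable_compact (e b : M -> R) (K : set M) : compact K ->
  measurable_fun setT (e : borel M -> R) -> continuous (b : M -> R^o) ->
  (forall x, ~ K x -> e x = 0) -> (forall x, `|e x| <= b x) ->
  vol.-integrable setT (EFin \o (e : borel M -> R)).
Proof.
move=> cK me cb e0 eb; have mK := closed_borel (compact_closed M_hausdorff cK).
have -> : EFin \o (e : borel M -> R) = (EFin \o (e : borel M -> R)) \_ (K : set (borel M)).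
  apply/funext => x; rewrite patchE; case: ifPn => // /negP xK /=.
  by rewrite e0// => Kx; apply: xK; rewrite inE.
apply/(integrable_mkcond _ mK).
apply: measurable_bounded_integrable => //.
- exact: (compact_finite_volume M_hausdorff vol_riemannian cK).
- exact: measurable_funTS.
have [C C0 HC] := continuous_compact_bounded cK (fun x _ => cb x).
exists C; split; first exact: num_real.
move=> B CB x Kx /=; rewrite (le_trans (eb x))// (le_trans (ler_norm _))//.
by rewrite (le_trans (HC x Kx))// ltW.
Qed.

Definition flux (p : R) (u v : M -> R) (x : M) : R :=
  inner g x (p_field g p u x) (grad g v x).

Variables (p : R) (u : M -> R).
Hypotheses (p_gt1 : 1 < p) (Cu : Ck_mfd A 1 u).

Lemma fluxE v x : flux p u v x = grad_norm g u x `^ (p - 2) * grad_inner g u v x.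
Proof. exact: inner_p_field. Qed.

Lemma grad_norm_ge0 v x : 0 <= grad_norm g v x.
Proof. exact: sqrtr_ge0. Qed.

(** For [p < 2] the factor [|du| ^ (p - 2)] may blow up near critical points of [u]; one factor
    [|du|] of the Cauchy-Schwarz bound absorbs it. The result is continuous, so measurability of the
    flux is enough for integrability. *)
Lemma flux_bound v x :
  `|flux p u v x| <= grad_norm g u x `^ (p - 1) * grad_norm g v x.
Proof.
rewrite fluxE normrM ger0_norm ?powR_ge0//.
apply: le_trans (ler_wpM2l (powR_ge0 _ _) (grad_inner_CauchySchwarz _ _ _ _)) _.
rewrite mulrA ler_wpM2r ?grad_norm_ge0//.
rewrite -(@mulr_powRB1 _ _ (p - 1)) ?grad_norm_ge0 ?subr_gt0// mulrC.
by rewrite (_ : p - 1 - 1 = p - 2)//; ring.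
Qed.

Lemma measurable_flux v : Ck_mfd A 1 v ->
  measurable_fun setT (flux p u v : borel M -> R).
Proof.
move=> Cv; rewrite (_ : flux p u v = fun x => grad_norm g u x `^ (p - 2) * grad_inner g u v x); last first.
  by apply/funext => x; exact: fluxE.
apply: measurable_funM; last by apply: continuous_borel_measurable; exact: continuous_grad_inner.
apply: (measurableT_comp (measurable_powR (p - 2))).
by apply: continuous_borel_measurable; exact: continuous_grad_norm.
Qed.

Lemma flux_near v w x : (\forall y \near x, v y = w y) -> flux p u v x = flux p u w x.
Proof. by move=> vw; rewrite !fluxE (grad_inner_near g u vw). Qed.

Lemma flux0 x : flux p u (fun=> 0) x = 0.
Proof.
rewrite fluxE; have d0 : differentiable_mfd A (fun=> 0) x by exact: differentiable_cst.
have := grad_innerDr g u d0 d0; rewrite (_ : (fun y => 0 + 0) = (fun=> 0)).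
  by move=> /eqP; rewrite -subr_eq0 opprD addrA subrr sub0r oppr_eq0 => /eqP->; rewrite mulr0.
by apply/funext => y; rewrite addr0.
Qed.

Lemma fluxD v w x : differentiable_mfd A v x -> differentiable_mfd A w x ->
  flux p u (fun y => v y + w y) x = flux p u v x + flux p u w x.
Proof. by move=> dv dw; rewrite !fluxE grad_innerDr// mulrDr. Qed.

Lemma flux_out (K : set M) v x : closed K -> (forall y, ~ K y -> v y = 0) -> ~ K x ->
  flux p u v x = 0.
Proof.
move=> cK v0 xK; rewrite -(flux0 x).
have oK : open (~` K) by rewrite openC.
apply: flux_near; near=> y; apply: v0.
by near: y; exact: (open_nbhs_nbhs (conj oK xK)).
Unshelve. all: by end_near. Qed.

Lemma integrable_flux v (K : set M) : compact K -> Ck_mfd A 1 v ->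
  (forall x, ~ K x -> v x = 0) ->
  vol.-integrable setT (EFin \o (flux p u v : borel M -> R)).
Proof.
move=> cK Cv v0; apply: (integrable_compact cK (measurable_flux Cv) _ _ (flux_bound v)).
  move=> x; apply: (@continuousM _ _ (fun x => grad_norm g u x `^ (p - 1)) (grad_norm g v)).
    apply: continuous_powR_nneg; first by rewrite subr_ge0 ltW.
      exact: grad_norm_ge0.
    exact: continuous_grad_norm.
  exact: continuous_grad_norm.
by move=> x; apply: flux_out v0 => //; exact: compact_closed.
Qed.

Lemma integrable_mul (h v : M -> R) (K : set M) : compact K ->
  continuous (h : M -> R^o) -> continuous (v : M -> R^o) ->
  (forall x, ~ K x -> v x = 0) ->
  vol.-integrable setT (EFin \o ((fun x => h x * v x) : borel M -> R)).
Proof.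
move=> cK ch cv v0.
have chv : continuous ((fun x => h x * v x) : M -> R^o).
  by move=> x; apply: continuousM; [exact: ch|exact: cv].
apply: (@integrable_compact _ (fun x => `|h x * v x|) K) => //.
- exact: continuous_borel_measurable.
- move=> x; apply: (@continuous_comp _ _ _ (fun x => h x * v x) Num.norm).
    exact: chv.
  exact: norm_continuous.
- by move=> x /v0->; rewrite mulr0.
Qed.

Variable h : M -> R.
Hypothesis h_continuous : continuous (h : M -> R^o).
Hypothesis u_solution : plaplacian_ge g vol p [set: M] u h.

(** The two sides of the weak inequality gathered in one integrand: testing with [v] says that its
    integral is at most 0, so weak inequalities can be compared pointwise. *)
Definition weak_form (v : M -> R) (x : borel M) : R := h x * v x + flux p u v x.

Lemma integrable_weak_form v (K : set M) : compact K -> Ck_mfd A 1 v ->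
  (forall x, ~ K x -> v x = 0) ->
  vol.-integrable setT (EFin \o weak_form v).
Proof.
move=> cK Cv v0.
have := integrableD measurableT
  (integrable_mul cK h_continuous (Ck_mfd_continuous Cv) v0) (integrable_flux cK Cv v0).
by apply: eq_integrable => // x _; rewrite /= EFinD.
Qed.

Lemma weak_form_smooth w (K : set M) : compact K -> smooth_mfd A w ->
  (forall x, 0 <= w x) -> (forall x, ~ K x -> w x = 0) ->
  \int[vol]_x weak_form w x <= 0.
Proof.
move=> cK sw w0 wK.
have clK : closure [set x | w x != 0] `<=` K.
  rewrite [X in _ `<=` X]((closure_id K).1 _); last exact: compact_closed.
  apply: closure_subset => x /eqP wx; apply: contrapT => xK.
  by apply: wx; exact: wK.
have tw : test_function A [set: M] w.
  split => //; apply: subclosed_compact cK clK; exact: closed_closure.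
rewrite /weak_form RintegralD//; last 2 first.
- exact: (integrable_mul cK h_continuous (Ck_mfd_continuous (sw 0)) wK).
- exact: (integrable_flux cK (sw 1%N) wK).
by rewrite -lerBrDr sub0r; exact: u_solution.
Qed.

End flux.

Section C1_test_functions.
Context {R : realType} {m : nat} {M : ptopologicalType}.
Variables (A : smooth_atlas R m M) (g : riemannian_metric A).
Variable vol : {measure set (borel M) -> \bar R}.
Hypothesis M_hausdorff : hausdorff_space M.
Hypothesis vol_riemannian : is_riemannian_measure g vol.
Variables (p : R) (u h : M -> R).
Hypotheses (p_gt1 : 1 < p) (Cu : Ck_mfd A 1 u).
Hypothesis h_continuous : continuous (h : M -> R^o).
Hypothesis u_solution : plaplacian_ge g vol p [set: M] u h.
Local Notation W := (weak_form g p u h).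

Lemma weak_formD v w x : differentiable_mfd A v x -> differentiable_mfd A w x ->
  W (fun y => v y + w y) x = W v x + W w x.
Proof. by move=> dv dw; rewrite /weak_form (fluxD g p u dv dw); ring. Qed.

(** A smooth approximation [w] of the product satisfies the inequality, while [weak_form] changes by
    at most [(Ch + Cg) d] on the patch and not at all outside it. The patch has finite volume and
    [d] is arbitrary. *)
Lemma integral_weak_form_patch (i : chart_ix A) c (lam : R) (q : M -> R) :
  0 < lam -> simplex c lam `<=` chart_im i -> Ck_mfd A 1 q -> (forall x, 0 <= q x) ->
  \int[vol]_x W (fun x => patch_bump i c lam x * q x) x <= 0.
Proof.
move=> lam0 sub Cq q0; pose v x := patch_bump i c lam x * q x.
change (\int[vol]_x W v x <= 0).
pose D : set M := patch_set i c lam.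
have cD : compact D by exact: compact_patch_set.
have clD : closed D by exact: closed_patch_set.
have v0 x : ~ D x -> v x = 0 by move=> xD; rewrite /v patch_bump_out ?mul0r.
have Cv : Ck_mfd A 1 v := Ck_mfdM (smooth_patch_bump M_hausdorff lam0 sub 1%N) Cq.
have [Ch Ch0 HCh] : exists2 C, 0 <= C & forall x, D x -> `|h x| <= C.
  by apply: continuous_compact_bounded => // x _; exact: h_continuous.
have [Cg Cg0 HCg] : exists2 C, 0 <= C & forall x, D x -> `|grad_norm g u x `^ (p - 1)| <= C.
  apply: continuous_compact_bounded => // x _; apply: continuous_powR_nneg.
  - by rewrite subr_ge0 ltW.
  - exact: grad_norm_ge0.
  - exact: continuous_grad_norm.
pose e1 : borel M -> R := \1_(D : set (borel M)).
have ie1 : vol.-integrable setT (EFin \o e1).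
  apply: (@integrable_compact _ _ _ _ _ vol M_hausdorff vol_riemannian _ (fun=> 1) D) => //.
  - by apply: measurable_indic; exact: closed_borel.
  - by move=> x; exact: cst_continuous.
  - by move=> x xD; rewrite /e1 indicE memNset.
  - by move=> x; rewrite /e1 indicE ger0_norm ?ler0n// lern1 leq_b1.
pose I := \int[vol]_x e1 x.
have I0 : 0 <= I by apply: Rintegral_ge0 => x _; rewrite /e1 indicE ler0n.
apply/ler_addgt0Pr => e e0; rewrite add0r.
pose B := (Ch + Cg) * I; have B0 : 0 <= B by rewrite mulr_ge0 ?addr_ge0.
(* [B] is the error per unit of [d]; it may be 0, hence [B + 1]. *)
pose d := e / (B + 1); have d0 : 0 < d by rewrite divr_gt0// ltr_wpDl.
have [w [sw w0 wD wv]] := approx_patch g M_hausdorff lam0 sub Cq q0 d0.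
pose r x := w x - v x.
have Cr : Ck_mfd A 1 r.
  exact: (Ck_mfdD (sw 1%N) (Ck_mfdN Cv)).
have intw := integrable_weak_form M_hausdorff vol_riemannian p_gt1 Cu h_continuous cD (sw 1%N) wD.
have intv := integrable_weak_form M_hausdorff vol_riemannian p_gt1 Cu h_continuous cD Cv v0.
have intde : vol.-integrable setT (EFin \o (fun x => (Ch + Cg) * d * e1 x)).
  by have := integrableZl measurableT ((Ch + Cg) * d) ie1; apply: eq_integrable.
have le1 x : W v x <= W w x + (Ch + Cg) * d * e1 x.
  have -> : W w x = W v x + W r x.
    rewrite -weak_formD; [|exact: Ck_mfd_differentiable..].
    by congr (W _ x); apply/funext => y; rewrite /r addrC subrK.
  rewrite -addrA lerDl /weak_form.
  have [xD|xD] := pselect (D x); last first.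
    have r0 y : ~ D y -> r y = 0 by move=> yD; rewrite /r wD// v0// subrr.
    by rewrite (flux_out g p u clD r0 xD) r0// mulr0 add0r add0r /e1 indicE memNset// mulr0.
  rewrite /e1 indicE mem_set// mulr1.
  have [rd gd] := wv x xD.
  have a1 : `|h x * r x| <= Ch * d by rewrite normrM ler_pM// HCh.
  have a2 : `|flux g p u r x| <= Cg * d.
    apply: le_trans (flux_bound g u p_gt1 r x) _; apply: ler_pM.
    - exact: powR_ge0.
    - exact: grad_norm_ge0.
    - by apply: le_trans (HCg x xD); exact: ler_norm.
    - exact: gd.
  move: a1 a2; rewrite !ler_norml => /andP[a1 _] /andP[a2 _].
  rewrite mulrDl; lra.
apply: le_trans (_ : \int[vol]_x (W w x + (Ch + Cg) * d * e1 x) <= _).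
  apply: le_Rintegral => //.
  have := integrableD measurableT intw intde.
  by apply: eq_integrable => // x _; rewrite /= EFinD.
rewrite (RintegralD measurableT intw intde) (RintegralZl _ measurableT ie1).
have := weak_form_smooth M_hausdorff vol_riemannian p_gt1 Cu h_continuous u_solution cD sw w0 wD.
rewrite -/I => H; apply: le_trans (lerD H (lexx _)) _; rewrite add0r mulrAC -/B.
by rewrite /d mulrCA ler_piMr ?(ltW e0)// ler_pdivrMr ?ltr_wpDl// mul1r lerDl.
Qed.

Lemma integral_weak_form_C1 (v : M -> R) (K : set M) : compact K -> Ck_mfd A 1 v ->
  (forall x, 0 <= v x) -> (forall x, ~ K x -> v x = 0) ->
  \int[vol]_x W v x <= 0.
Proof.
move=> cK Cv v0 vK; have clK := compact_closed M_hausdorff cK.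
have [c [lam Hcl]] := patch_family A.
have [s Hs] := patch_finite_cover M_hausdorff Hcl cK.
pose b z := patch_bump (chart_at A z) (c z) (lam z).
have Cb z k : Ck_mfd A k (b z).
  by have [l0 sub _] := Hcl z; exact: smooth_patch_bump.
have b0 z x : 0 <= b z x by exact: patch_bump_ge0.
pose S x := \sum_(z <- s) b z x.
have CS k : Ck_mfd A k S by apply: Ck_mfd_sum => z; exact: Cb.
have SK x : K x -> 0 < S x.
  move=> /Hs[z zs bz]; rewrite /S (big_rem z)//=.
  by rewrite ltr_pwDl// sumr_ge0.
(* As [S > 0] on [K], the function [v] vanishes wherever [S] does, and [q] is 0 there. *)
pose q x := (S x)^-1 * v x.
have S0 x : 0 <= S x by exact: sumr_ge0.
have q0 x : 0 <= q x by rewrite mulr_ge0// invr_ge0.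
have qK x : ~ K x -> q x = 0 by move=> /vK vx; rewrite /q vx mulr0.
(* A quotient of C^1 functions on the open set [S > 0], which contains [K], and 0 on the open
   complement of [K]. *)
have Cq : Ck_mfd A 1 q.
  apply: Ck_mfd_local => x; have [xK|xK] := pselect (K x); last first.
    exists (~` K); split; first exact: xK.
    have oK : open (~` K) by rewrite openC.
    by apply: (Ck_in_ext oK _ (Ck_in_cst (A := A) 1 (~` K) 0)) => y /qK.
  have oS : open [set y | 0 < S y].
    have /continuousP cS := Ck_mfd_continuous (CS 0); exact: (cS _ (@open_gt R 0)).
  exists [set y | 0 < S y]; split; first exact: SK.
  apply: (Ck_inM oS _ (Ck_mfd_in _ Cv)).
  apply: (C1_in_comp (s := fun t => t^-1) (ds := fun t => - t ^- 2) oS (Ck_mfd_in _ (CS 1%N))).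
    move=> y Sy; have Sn : S y != 0 by rewrite gt_eqF.
    have := @deriveV _ _ (@id R) (S y) 1 Sn (@derivable_id _ _ _ _).
    rewrite derive_id => dE; split; first exact: derivableV.
    by rewrite dE; rewrite [_ *: _]mulr1.
  move=> y Sy; have Sn : S y != 0 by rewrite gt_eqF.
  apply: continuousN; apply: continuousV; first by rewrite expf_neq0.
  exact: exprn_continuous.
have vE : v = fun x => \sum_(z <- s) b z x * q x.
  apply/funext => x; rewrite -mulr_suml -/(S x) /q mulrA.
  have [Sx|Sx] := eqVneq (S x) 0; last by rewrite divff// mul1r.
  rewrite vK ?mulr0// => /SK; by rewrite Sx ltxx.
have Cbq z : Ck_mfd A 1 (fun x => b z x * q x) := Ck_mfdM (Cb z 1%N) Cq.
have bqK z x : ~ K x -> b z x * q x = 0 by move=> /qK->; rewrite mulr0.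
have int_W w : Ck_mfd A 1 w -> (forall x, ~ K x -> w x = 0) ->
    vol.-integrable setT (EFin \o W w).
  exact: (integrable_weak_form M_hausdorff vol_riemannian p_gt1 Cu h_continuous cK).
have step (t : seq M) : \int[vol]_x W (fun x => \sum_(z <- t) b z x * q x) x <= 0.
  elim: t => [|z t IH].
    have -> : (fun x => \sum_(z <- [::]) b z x * q x) = (fun=> 0).
      by apply/funext => x; rewrite big_nil.
    have E x : W (fun=> 0) x = 0 by rewrite /weak_form flux0 mulr0 addr0.
    by under eq_Rintegral do rewrite E; rewrite Rintegral_cst//= mul0r.
  pose vt x := \sum_(z <- t) b z x * q x.
  have Ct : Ck_mfd A 1 vt := Ck_mfd_sum t Cbq.
  have vtK x : ~ K x -> vt x = 0.
    by move=> xK; rewrite /vt big1// => y _; exact: bqK.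
  have -> : (fun x => \sum_(y <- z :: t) b y x * q x) = (fun x => b z x * q x + vt x).
    by apply/funext => x; rewrite big_cons.
  have E x : W (fun x => b z x * q x + vt x) x = W (fun x => b z x * q x) x + W vt x.
    have d1 := @Ck_mfd_differentiable _ _ _ A _ x (Cbq z); have d2 := @Ck_mfd_differentiable _ _ _ A _ x Ct.
    exact: (weak_formD d1 d2).
  under eq_Rintegral do rewrite E.
  rewrite (RintegralD measurableT (int_W _ (Cbq z) (bqK z)) (int_W _ Ct vtK)).
  rewrite -[leRHS]addr0; apply: lerD; last exact: IH.
  have [l0 sub _] := Hcl z; exact: integral_weak_form_patch.
by rewrite vE; exact: step.
Qed.

End C1_test_functions.

(** * The change of variable *)

Section antiderivatives.
Context {R : realType}.
Local Notation mu := (@lebesgue_measure R).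

Lemma continuous_itv_integrable (f : R -> R) (a b : R) : continuous f ->
  mu.-integrable `[a, b] (EFin \o f).
Proof.
move=> cf; apply: continuous_compact_integrable; first exact: segment_compact.
exact: continuous_subspaceT.
Qed.

Lemma is_derive_primitive (f : R -> R) (a t : R) : continuous f -> a < t ->
  is_derive t 1 (primitive f a) (f t).
Proof.
move=> cf at_; have t1 : t < t + 1 by rewrite ltrDl.
have [d e] := continuous_FTC1_closed t1 (continuous_itv_integrable a (t + 1) cf) at_ (cf t).
by split; [exact: d|rewrite -derive1E].
Qed.

Lemma is_derive_continuous (f : R -> R) (d t : R) : is_derive t 1 (f : R -> R^o) d ->
  {for t, continuous f}.
Proof.
move=> df; apply: (@differentiable_continuous _ R^o R^o); apply/derivable1_diffP.
by have [] := df.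
Qed.

Lemma is_derive_mvt (f df : R -> R) (a b : R) : a < b ->
  (forall t, a <= t -> t <= b -> is_derive t 1 f (df t)) ->
  exists t, [/\ a <= t, t <= b & f b - f a = df t * (b - a)].
Proof.
move=> ab H.
have cf : {within `[a, b], continuous f}.
  apply: derivable_within_continuous => t; rewrite in_itv/= => /andP[t0 t1].
  by have [] := H t t0 t1.
have dopen (t : R) : t \in `]a, b[ -> is_derive t 1 f (df t).
  by rewrite in_itv/= => /andP[t0 t1]; apply: H; exact: ltW.
have [t] := MVT ab dopen cf; rewrite in_itv/= => /andP[t0 t1] E.
by exists t; split => //; exact: ltW.
Qed.

Lemma is_derive_increasing (f df : R -> R) (a b : R) : a < b ->
  (forall t, a <= t -> is_derive t 1 f (df t)) -> (forall t, a <= t -> 0 < df t) ->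
  f a < f b.
Proof.
move=> ab H df0; have [t [t0 t1 E]] := is_derive_mvt ab (fun t t0 _ => H t t0).
by rewrite -subr_gt0 E mulr_gt0 ?subr_gt0// df0.
Qed.

Lemma primitive_gt0 (f : R -> R) (a t : R) : continuous f ->
  (forall s, a < s -> 0 < f s) -> a < t -> 0 < primitive f a t.
Proof.
(* Positivity of [f] and the derivative of the primitive are available only beyond [a]; so the
   primitive is shown to be nonnegative at a midpoint and strictly increasing from there. *)
move=> cf f0 at_; pose s := (a + t) / 2.
have as_ : a < s by rewrite /s; lra.
have st : s < t by rewrite /s; lra.
apply: (@le_lt_trans _ _ (primitive f a s)); last first.
  apply: (is_derive_increasing (df := f) st) => r sr.
    by apply: is_derive_primitive => //; exact: lt_le_trans sr.
  by apply: f0; exact: lt_le_trans sr.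
rewrite /primitive -Rintegral_itv_obnd_cbnd; last first.
  apply: (integrableS _ _ _ (continuous_itv_integrable a s cf)) => //.
  by move=> r /=; rewrite !in_itv/= => /andP[/ltW-> ->].
by apply: Rintegral_ge0 => r /=; rewrite in_itv/= => /andP[/f0/ltW].
Qed.

(** [primitive] integrates from a base point and is 0 before it, so it is applied to [g - g a],
    which vanishes up to [a]; the linear function [g a * t] restores the constant. *)
Lemma exists_antiderivative (g : R -> R) (a : R) : continuous g ->
  (forall t, t <= a -> g t = g a) -> exists G : R -> R, forall t : R, is_derive t 1 G (g t).
Proof.
move=> cg ga; pose g0 t := g t - g a.
have cg0 : continuous g0 by move=> t; apply: continuousB; [exact: cg|exact: cst_continuous].
exists (primitive g0 (a - 1) + ( *%R (g a))) => t.
rewrite (_ : g t = g0 t + g a); last by rewrite /g0 subrK.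
apply: is_deriveD; last first.
  apply: (is_derive_eq (is_deriveZ (g a) (is_derive_id t 1))).
  by rewrite [_ *: _]mulr1.
have [ta|ta] := ltP t a; last first.
  by apply: is_derive_primitive => //; rewrite ltrBlDr (le_lt_trans ta)// ltrDl.
have -> : g0 t = 0 by rewrite /g0 ga ?subrr// ltW.
apply: (@near_eq_is_derive _ _ _ (cst 0)).
near=> s; rewrite /primitive; apply/esym.
rewrite (_ : \int[_]_(r in _) _ = \int[mu]_(r in `[(a - 1), s]) (cst 0 r)).
  by rewrite /Rintegral integral0.
apply: eq_Rintegral => r; rewrite inE/= in_itv/= => /andP[_ rs].
rewrite /g0 ga ?subrr// (le_trans rs)//.
by near: s; exact: lt_le_nbhsl.
Unshelve. all: by end_near. Qed.

Lemma antiderivative_bounded (G g : R -> R) (a : R) : continuous g ->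
  (forall t, 0 < g t) -> (forall t : R, is_derive t 1 G (g t)) ->
  mu.-integrable `[a, +oo[ (EFin \o g) -> exists B, forall t : R, G t <= B.
Proof.
move=> cg g0 dG ig.
have fin : (\int[mu]_(t in `[a, +oo[) (g t)%:E)%E \is a fin_num by exact: integrable_fin_num.
exists (G a + fine (\int[mu]_(t in `[a, +oo[) (g t)%:E)) => t.
(* The fundamental theorem is applied on [[a, b]] with [a < b]; a smaller [t] is covered by
   monotonicity. *)
pose b := Num.max t (a + 1).
have ab : a < b by rewrite lt_max ltrDl ltr01 orbT.
apply: (@le_trans _ _ (G b)).
  have : t <= b by rewrite le_max lexx.
  rewrite le_eqVlt => /predU1P[->//|tb].
  exact/ltW/(is_derive_increasing (df := g) tb).
have cG s : {for s, continuous G} by exact: is_derive_continuous (dG s).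
have E : (\int[mu]_(t in `[a, b]) (g t)%:E = (G b)%:E - (G a)%:E)%E.
  apply: continuous_FTC2 => //; first exact: continuous_subspaceT.
    split.
    - by move=> s _; have [] := dG s.
    - exact/cvg_at_right_filter/cG.
    - exact/cvg_at_left_filter/cG.
  by move=> s _; rewrite derive1E; have [] := dG s.
rewrite -lerBlDl -lee_fin fineK// EFinB -E.
apply: ge0_subset_integral => //.
- by apply/measurable_EFinP; apply: measurable_funTS; exact: continuous_measurable_fun.
- by move=> s _; rewrite lee_fin ltW.
- by move=> s /=; rewrite !in_itv/= andbT => /andP[].
Qed.

End antiderivatives.

(** * The change of variable in the differential inequality *)

(** Here [s] stands for [|du|] and [z] for [|dw|], so [s = F ^ b z]. Since [b (chi + 1) = 1], the
    right-hand side becomes [z ^ (p - 1 - chi) f F ^ (- chi b) (1 - (p - 1) b z ^ (chi + 1))], where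
    [f F ^ (- chi b)] is at least [1 / cF] and the last factor at least [1 / 2]. *)
Lemma keller_osserman_pointwise {R : realType} (p chi F f s cF : R) :
  1 < p -> -1 < chi -> chi <= p - 1 -> 0 < F -> 0 < f -> 0 < cF -> 0 <= s ->
  F `^ (chi / (chi + 1)) <= cF * f ->
  let b := (chi + 1)^-1 in let z := F `^ (- b) * s in
  (p - 1) * b * z `^ (chi + 1) <= 2^-1 ->
  (2 * cF)^-1 * z `^ (p - 1 - chi) <=
    f * s `^ (p - 1 - chi) * F `^ (- b * (p - 1)) +
    - b * (p - 1) * F `^ (- b * (p - 1) - 1) * f * s `^ p.
Proof.
move=> p1 chi1 chip F0 f0 cF0 s0 Ff b z zs.
have chi0 : 0 < chi + 1 by lra.
have bchi : b * (chi + 1) = 1 by rewrite /b mulVf// gt_eqF.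
have b0 : 0 < b by rewrite invr_gt0.
have Fn0 : F != 0 by rewrite gt_eqF.
have z0 : 0 <= z by rewrite mulr_ge0 ?powR_ge0.
have sE : s = F `^ b * z.
  by rewrite /z mulrA -powRD ?Fn0 ?implybT// subrr powRr0 mul1r.
have sp r : s `^ r = F `^ (b * r) * z `^ r.
  by rewrite sE powRM ?powR_ge0// powRrM.
(* [z] may be 0; the power still splits because the sum [p] of the exponents is not 0. *)
have zp : z `^ p = z `^ (p - 1 - chi) * z `^ (chi + 1).
  have pE : p - 1 - chi + (chi + 1) = p by ring.
  rewrite -powRD pE//; apply/implyP => /eqP; lra.
have e1 : F `^ (b * (p - 1 - chi)) * F `^ (- b * (p - 1)) = (F `^ (chi / (chi + 1)))^-1.
  rewrite -powRD ?Fn0 ?implybT// -powRN; congr (_ `^ _); rewrite -/b. ring.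
have e2 : F `^ (- b * (p - 1) - 1) * F `^ (b * p) = (F `^ (chi / (chi + 1)))^-1.
  rewrite -powRD ?Fn0 ?implybT// -powRN; congr (_ `^ _); rewrite -/b.
  have -> : - b * (p - 1) - 1 + b * p = b * (chi + 1) - 1 - b * chi by ring.
  by rewrite bchi subrr sub0r mulrC.
set N := F `^ (chi / (chi + 1)) in Ff e1 e2.
have N0 : 0 < N by exact: powR_gt0.
have -> : f * s `^ (p - 1 - chi) * F `^ (- b * (p - 1)) +
    - b * (p - 1) * F `^ (- b * (p - 1) - 1) * f * s `^ p =
    z `^ (p - 1 - chi) * (f / N * (1 - (p - 1) * b * z `^ (chi + 1))).
  rewrite !sp zp.
  transitivity (f * (F `^ (b * (p - 1 - chi)) * F `^ (- b * (p - 1))) * z `^ (p - 1 - chi) -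
    b * (p - 1) * f * (F `^ (- b * (p - 1) - 1) * F `^ (b * p)) *
    (z `^ (p - 1 - chi) * z `^ (chi + 1))); first ring.
  by rewrite e1 e2; ring.
rewrite mulrC ler_wpM2l ?powR_ge0//.
have fN : cF^-1 <= f / N.
  by rewrite ler_pdivlMr// ler_pdivrMl.
rewrite invfM mulrC; apply: ler_pM => //; first by rewrite invr_ge0 ltW.
lra.
Qed.

Section composition.
Context {R : realType} {m : nat} {M : ptopologicalType}.
Variables (A : smooth_atlas R m M) (g : riemannian_metric A).
Variables (p : R) (u : M -> R).
Hypothesis p_gt1 : 1 < p.

Lemma grad_norm_comp (s : R -> R) d x : differentiable_mfd A u x ->
  is_derive (u x) 1 (s : R -> R^o) d -> 0 <= d ->
  grad_norm g (s \o u) x = d * grad_norm g u x.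
Proof.
move=> du ds d0; rewrite !grad_normE (grad_inner_compr g _ du ds) (grad_inner_compl g _ du ds).
by rewrite mulrA -expr2 sqrtrM ?sqr_ge0// sqrtr_sqr ger0_norm.
Qed.

Lemma flux_compl (s : R -> R) d v x : differentiable_mfd A u x ->
  is_derive (u x) 1 (s : R -> R^o) d -> 0 < d ->
  flux g p (s \o u) v x = d `^ (p - 1) * flux g p u v x.
Proof.
move=> du ds d0; rewrite !fluxE (grad_norm_comp du ds (ltW d0)) (grad_inner_compl g v du ds).
rewrite powRM ?(ltW d0) ?grad_norm_ge0//.
have -> : d `^ (p - 1) = d * d `^ (p - 2).
  by rewrite -(@mulr_powRB1 _ _ (p - 1)) ?(ltW d0) ?subr_gt0//; congr (_ * _ `^ _); ring.
ring.
Qed.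

Lemma flux_compr (s : R -> R) d v x : differentiable_mfd A v x ->
  is_derive (v x) 1 (s : R -> R^o) d ->
  flux g p u (s \o v) x = d * flux g p u v x.
Proof. by move=> dv ds; rewrite !fluxE (grad_inner_compr g u dv ds) mulrCA. Qed.

Lemma fluxM v w x : differentiable_mfd A v x -> differentiable_mfd A w x ->
  flux g p u (fun y => v y * w y) x = v x * flux g p u w x + w x * flux g p u v x.
Proof. by move=> dv dw; rewrite !fluxE (grad_innerMr g u dv dw); ring. Qed.

Lemma flux_self x : flux g p u u x = grad_norm g u x `^ p.
Proof.
have p0 : 0 < p by exact: lt_trans p_gt1.
have p1 : 0 < p - 1 by rewrite subr_gt0.
rewrite fluxE -sqr_grad_norm -(mulr_powRB1 (grad_norm_ge0 g u x) p0).
rewrite -(mulr_powRB1 (grad_norm_ge0 g u x) p1) (_ : p - 1 - 1 = p - 2); last ring.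
by ring.
Qed.

End composition.

(** * Transfer of the weak inequality *)

Section comparison.
Context {R : realType} {m : nat} {M : ptopologicalType}.
Variables (A : smooth_atlas R m M) (g : riemannian_metric A).
Variable vol : {measure set (borel M) -> \bar R}.
Hypothesis M_hausdorff : hausdorff_space M.
Hypothesis vol_riemannian : is_riemannian_measure g vol.
Variables (p : R) (u h : M -> R).
Hypotheses (p_gt1 : 1 < p) (Cu : Ck_mfd A 1 u).
Hypothesis h_continuous : continuous (h : M -> R^o).
Hypothesis u_solution : plaplacian_ge g vol p [set: M] u h.

(** To pass from [u] to [w], each test function [psi] for [w] is turned into a C^1 test function [v]
    for [u], supported where [psi] is, so that the integrands compare pointwise. As the support lies
    in [O], integrals over [O] are integrals over [M]. *)
Lemma plaplacian_ge_comparison (O : set M) (w h0 : M -> R) :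
  Ck_mfd A 1 w -> continuous (h0 : M -> R^o) ->
  (forall psi : M -> R, test_function A O psi -> (forall x, 0 <= psi x) ->
    exists v, [/\ Ck_mfd A 1 v, forall x, 0 <= v x,
      forall x, ~ closure [set x | psi x != 0] x -> v x = 0 &
      forall x, closure [set x | psi x != 0] x ->
        h0 x * psi x + flux g p w psi x <= weak_form g p u h v x]) ->
  plaplacian_ge g vol p O w h0.
Proof.
move=> Cw ch0 H psi tpsi psi0; have [v [Cv v0 vK le_v]] := H psi tpsi psi0.
have [spsi cK KO] := tpsi; set K := closure _ in cK KO vK le_v.
have psiK x : ~ K x -> psi x = 0.
  by move=> xK; apply: contrapT => /eqP px; apply: xK; exact: subset_closure.
have clK : closed K by exact: closed_closure.
have fluxK x : ~ K x -> flux g p w psi x = 0 by move=> xK; exact: (flux_out g p w clK psiK).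
have restrictO (e : borel M -> R) : (forall x, ~ K x -> e x = 0) ->
    \int[vol]_(x in O) e x = \int[vol]_x e x.
  move=> eK; rewrite Rintegral_mkcond; apply: eq_Rintegral => x _.
  rewrite patchE; case: ifPn => // /negP xO; rewrite eK// => /KO Ox.
  by apply: xO; rewrite inE.
rewrite (restrictO (fun x => h0 x * psi x)); last by move=> x /psiK->; rewrite mulr0.
rewrite (restrictO (fun x => flux g p w psi x) fluxK).
have i1 := integrable_mul M_hausdorff vol_riemannian cK ch0 (Ck_mfd_continuous (spsi 0)) psiK.
have i2 := integrable_flux M_hausdorff vol_riemannian p_gt1 Cw cK (spsi 1%N) psiK.
have i3 := integrable_weak_form M_hausdorff vol_riemannian p_gt1 Cu h_continuous cK Cv vK.
rewrite -subr_le0 opprK -(RintegralD measurableT i1 i2).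
apply: le_trans (integral_weak_form_C1 M_hausdorff vol_riemannian p_gt1 Cu
  h_continuous u_solution cK Cv v0 vK).
have i12 : vol.-integrable setT
    (EFin \o (fun x : borel M => h0 x * psi x + flux g p w psi x)).
  have := integrableD measurableT i1 i2.
  by apply: eq_integrable; [exact: measurableT|move=> x _; rewrite /= EFinD].
apply: (le_Rintegral measurableT i12 i3) => x _; have [xK|xK] := pselect (K x); first exact: le_v.
by rewrite psiK// fluxK// /weak_form vK// (flux_out g p u clK vK xK) !mulr0.
Qed.

End comparison.

Section keller_osserman_change_of_variable.
Context {R : realType} {m : nat} {M : ptopologicalType}.
Variables (A : smooth_atlas R m M) (g : riemannian_metric A).
Variable vol : {measure set (borel M) -> \bar R}.
Hypothesis M_hausdorff : hausdorff_space M.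
Hypothesis vol_riemannian : is_riemannian_measure g vol.
Variables (p chi eta0 cF : R) (f : R -> R) (u : M -> R).
Hypotheses (p_gt1 : 1 < p) (chi_gt : -1 < chi) (chi_le : chi <= p - 1).
Hypothesis f_continuous : continuous f.
Hypothesis f_gt0 : forall t, eta0 < t -> 0 < f t.
Hypothesis cF_gt0 : 0 < cF.
Hypothesis F_le_f : forall t, eta0 < t ->
  primitive f eta0 t `^ (chi / (chi + 1)) <= cF * f t.
Hypothesis Cu : Ck_mfd A 1 u.
Hypothesis u_solution : plaplacian_ge g vol p [set: M] u
  (fun x => f (u x) * grad_norm g u x `^ (p - 1 - chi)).
Local Notation F := (primitive f eta0).
Local Notation beta := ((chi + 1)^-1).

Lemma is_derive_powR_primitive r t : eta0 < t ->
  is_derive t 1 (fun s => F s `^ r) (r * F t `^ (r - 1) * f t).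
Proof.
move=> t0; have dF := is_derive_primitive f_continuous t0.
have D := @is_derive1_comp R (fun s => s `^ r) F t _ _ (is_derive1_powR r (primitive_gt0 f_continuous f_gt0 t0)) dF.
exact: D.
Qed.

Lemma continuous_mul_grad_norm_powR (r : R) (v w : M -> R) : Ck_mfd A 1 w -> 0 <= r ->
  continuous (v : M -> R^o) ->
  continuous ((fun x => v x * grad_norm g w x `^ r) : M -> R^o).
Proof.
move=> Cw r0 cv x; apply: (@continuousM _ _ v (fun x => grad_norm g w x `^ r)).
  exact: cv.
apply: continuous_powR_nneg => //; first exact: grad_norm_ge0.
exact: continuous_grad_norm.
Qed.

Lemma continuous_rhs : continuous ((fun x => f (u x) * grad_norm g u x `^ (p - 1 - chi)) : M -> R^o).
Proof.
apply: (continuous_mul_grad_norm_powR Cu); first by rewrite subr_ge0.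
move=> x; apply: (@continuous_comp _ _ _ u f); last exact: f_continuous.
exact: Ck_mfd_continuous Cu x.
Qed.

Variables (a eps : R) (phi : R -> R).
Hypothesis a_gt : eta0 < a.
(* Constant to the left of [a], so that [phi] is C^1 on the whole line. *)
Let dphi (t : R) : R := F (Num.max t a) `^ (- beta).
Hypothesis phi_derive : forall t : R, is_derive t 1 (phi : R -> R^o) (dphi t).
Hypothesis eps_le : forall z : R, 0 <= z -> z < eps ->
  (p - 1) * beta * z `^ (chi + 1) <= 2^-1.

Lemma dphi_gt0 t : 0 < dphi t.
Proof. by apply: powR_gt0; apply: (primitive_gt0 f_continuous f_gt0); rewrite lt_max a_gt orbT. Qed.

Lemma dphiE t : a <= t -> dphi t = F t `^ (- beta).
Proof. by move=> at_; rewrite /dphi max_l. Qed.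

Lemma continuous_dphi : continuous dphi.
Proof.
move=> t; apply: (@continuous_comp _ _ _ (fun t => Num.max t a) (fun s => F s `^ (- beta))).
  apply: (@continuous_max _ _ id (cst a)); first exact: cvg_id.
  exact: cst_continuous.
apply: is_derive_continuous (is_derive_powR_primitive (- beta) _).
by rewrite lt_max a_gt orbT.
Qed.

Lemma phi_increasing s t : s < t -> phi s < phi t.
Proof.
move=> st; apply: (is_derive_increasing (f := phi) (df := dphi) st) => r _.
exact: dphi_gt0.
Qed.

Lemma C1_phi_u : Ck_mfd A 1 (phi \o u).
Proof.
apply: Ck_mfd_local => x; exists setT; split; first by [].
apply: (C1_in_comp (s := phi) (ds := dphi) openT (Ck_mfd_in _ Cu)) => y _.
exact: continuous_dphi.
Qed.

(** By the product rule the flux of [u] against the modified test function has two terms. One is the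
    flux of [phi o u] against [psi], present on both sides; what remains is
    [keller_osserman_pointwise] multiplied by [psi]. *)
Lemma plaplacian_ge_phi_u :
  plaplacian_ge g vol p (superlevel_small_grad g (phi \o u) (phi a) eps) (phi \o u)
    (fun x => (2 * cF)^-1 * grad_norm g (phi \o u) x `^ (p - 1 - chi)).
Proof.
apply: (plaplacian_ge_comparison M_hausdorff vol_riemannian p_gt1 Cu continuous_rhs
  u_solution C1_phi_u).
  apply: (continuous_mul_grad_norm_powR C1_phi_u); first by rewrite subr_ge0.
  by move=> x; exact: cst_continuous.
move=> psi [spsi cK KO] psi0; set K := closure _ in cK KO *.
(* Equal to [dphi t ^ (p - 1)] for [t >= a], but not frozen to the left of [a], hence C^1 for
   [t > eta0]. *)
pose s t : R := F t `^ (- beta * (p - 1)).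
have clK : closed K by exact: closed_closure.
have psiK x : ~ K x -> psi x = 0.
  by move=> xK; apply: contrapT => /eqP px; apply: xK; exact: subset_closure.
have Ka x : K x -> a < u x.
  move=> /KO[/= + _]; apply: contraTlt; rewrite le_eqVlt => /predU1P[->|ux].
    by rewrite ltxx.
  by rewrite -leNgt ltW// phi_increasing.
have oU : open [set x | eta0 < u x].
  have /continuousP cu := Ck_mfd_continuous Cu; exact: (cu _ (@open_gt R eta0)).
have ds t : eta0 < t -> is_derive t 1 (s : R -> R^o)
    (- beta * (p - 1) * F t `^ (- beta * (p - 1) - 1) * f t).
  exact: is_derive_powR_primitive.
have Csu : Ck_in A 1 [set x | eta0 < u x] (s \o u).
  apply: (C1_in_comp (s := s) (ds := fun t => - beta * (p - 1) * F t `^ (- beta * (p - 1) - 1) * f t)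
    oU (Ck_mfd_in _ Cu)) => x ux.
  apply: continuousM; last exact: f_continuous.
  apply: continuousM; first exact: cst_continuous.
  exact: is_derive_continuous (is_derive_powR_primitive _ ux).
exists (fun x => s (u x) * psi x); split.
(* [s o u] is known to be C^1 only on [u > eta0], which contains the support of [psi]; off this
   support the product is 0. *)
- apply: Ck_mfd_local => x; have [xK|xK] := pselect (K x).
    exists [set x | eta0 < u x]; split; first exact: lt_trans a_gt (Ka x xK).
    exact: (Ck_inM oU Csu (Ck_mfd_in _ (spsi 1%N))).
  exists (~` K); split; first exact: xK.
  have oK : open (~` K) by rewrite openC.
  by apply: (Ck_in_ext oK _ (Ck_in_cst (A := A) 1 (~` K) 0)) => y /psiK->; rewrite mulr0.
- by move=> x; rewrite mulr_ge0// powR_ge0.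
- by move=> x /psiK->; rewrite mulr0.
move=> x xK; have au := Ka x xK; have eu : eta0 < u x by exact: lt_trans au.
have du : differentiable_mfd A u x := Ck_mfd_differentiable x Cu.
have dsu : differentiable_mfd A (s \o u) x := Ck_in_differentiable Csu eu.
have dpsi : differentiable_mfd A psi x := Ck_mfd_differentiable x (spsi 1%N).
rewrite /weak_form (fluxM g p u dsu dpsi) (flux_compr g p u du (ds _ eu)).
rewrite (@flux_self _ _ _ A g p u p_gt1 x).
rewrite (@flux_compl _ _ _ A g p u p_gt1 phi _ psi x du (phi_derive _) (dphi_gt0 _)).
rewrite dphiE ?(ltW au)// -powRrM.
rewrite (grad_norm_comp g du (phi_derive _) (ltW (dphi_gt0 _))) dphiE ?(ltW au)//.
have [_ zeps] := KO x xK.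
move: zeps; rewrite (grad_norm_comp g du (phi_derive _) (ltW (dphi_gt0 _))) dphiE ?(ltW au)// => zeps.
have gn0 := grad_norm_ge0 g u x.
have := @keller_osserman_pointwise R p chi (F (u x)) (f (u x)) (grad_norm g u x) cF
  p_gt1 chi_gt chi_le (primitive_gt0 f_continuous f_gt0 eu) (f_gt0 eu) cF_gt0 gn0 (F_le_f eu).
move=> /(_ (eps_le _ zeps)); rewrite mulr_ge0 ?powR_ge0// => /(_ isT).
move=> /(ler_wpM2r (psi0 x)) H; rewrite /s /=.
rewrite -lerBrDr; apply: (le_trans H); rewrite le_eqVlt; apply/predU1P; left.
ring.
Qed.

End keller_osserman_change_of_variable.

(** * Boundedness of [u] and the sign of [f] at its supremum *)

Theorem theorem8p6 (R : realType) (m : nat) (M : ptopologicalType)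
  (A : smooth_atlas R m M) (g : riemannian_metric A)
  (vol : {measure set (borel M) -> \bar R})
  (m_ge2 : (2 <= m)%N)
  (M_hausdorff : hausdorff_space M)
  (M_second_countable : @second_countable M)
  (M_connected : connected [set: M])
  (M_noncompact : ~ compact [set: M])
  (vol_riemannian : is_riemannian_measure g vol)
  (p chi eta0 : R) (f : R -> R)
  (p_gt1 : 1 < p) (chi_gt : -1 < chi) (chi_le : chi <= p - 1)
  (eta0_ge0 : 0 <= eta0)
  (f_continuous : continuous f)
  (f_gt0 : forall t, eta0 < t -> 0 < f t)
  (F_le_f : exists2 cF : R, 0 < cF & forall t, eta0 < t ->
     primitive f eta0 t `^ (chi / (chi + 1)) <= cF * f t)
  (u : M -> R)
  (u_C1 : Ck_mfd A 1 u)
  (u_nonconstant : nonconstant u)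
  (u_solution : plaplacian_ge g vol p [set: M] u
     (fun x => f (u x) * grad_norm g u x `^ (p - 1 - chi)))
  (SMP : strong_max_principle_at_infinity g vol p (fun t => t `^ (p - 1 - chi)))
  (KO : keller_osserman f eta0 chi) :
  has_ubound (range u) /\ f (sup (range u)) <= 0.
Proof.
have [cF cF0 Ff] := F_le_f.
have chi1 : 0 < chi + 1 by rewrite -ltrBlDr sub0r.
have r0 : 0 <= p - 1 - chi by rewrite subr_ge0.
have ch := @continuous_rhs _ _ _ A g p chi f u chi_le f_continuous u_C1.
have Hb : has_ubound (range u).
  apply: contrapT => unb; have [a a_gt ig] := KO.
  pose dphi t := primitive f eta0 (Num.max t a) `^ (- (chi + 1)^-1).
  have dphi0 : forall t, 0 < dphi t := dphi_gt0 chi f_continuous f_gt0 a_gt.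
  have cdphi : continuous dphi := @continuous_dphi _ chi _ _ f_continuous f_gt0 _ a_gt.
  have [phi Hphi] : exists phi : R -> R, forall t : R, is_derive t 1 phi (dphi t).
    by apply: (exists_antiderivative (a := a) cdphi) => t ta; rewrite /dphi (max_r ta) maxxx.
  have [B HB] : exists B, forall t : R, phi t <= B.
    apply: (antiderivative_bounded (a := a) cdphi dphi0 Hphi).
    move: ig; apply: eq_integrable; first exact: measurable_itv.
    by move=> t; rewrite inE/= in_itv/= andbT => at_; rewrite /dphi max_l.
  have incr := phi_increasing f_continuous f_gt0 a_gt Hphi.
  have C1w := C1_phi_u f_continuous f_gt0 u_C1 a_gt Hphi.
  have phi_inj : injective phi.
    by move=> s t E; case: (ltgtP s t) => // /incr; rewrite E ltxx.
  have wn : nonconstant (phi \o u).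
    move=> [k Hk]; apply: u_nonconstant; exists (u point) => x.
    by apply: phi_inj; rewrite -[phi (u x)]/((phi \o u) x) Hk -(Hk point).
  have wb : has_ubound (range (phi \o u)) by exists B => _ [x _ <-] /=.
  (* Being unbounded, [u] exceeds [a], so the level [phi a] is below the supremum of [phi o u], as
     the principle requires. *)
  have [x ax] : exists x, a < u x.
    apply: contrapT => H; apply: unb; exists a => _ [x _ <-].
    by rewrite leNgt; apply/negP => ax; apply: H; exists x.
  have ea : phi a < sup (range (phi \o u)).
    by apply: (lt_le_trans (incr _ _ ax)); apply: ub_le_sup => //; exists x.
  pose c := (p - 1) * (chi + 1)^-1.
  have c0 : 0 < c by rewrite mulr_gt0 ?invr_gt0// subr_gt0.
  (* The root of [c * z ^ (chi + 1) = 1 / 2]. *)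
  pose eps := (2^-1 / c) `^ (chi + 1)^-1.
  have eps0 : 0 < eps by rewrite powR_gt0// divr_gt0.
  have Heps z : 0 <= z -> z < eps -> (p - 1) * (chi + 1)^-1 * z `^ (chi + 1) <= 2^-1.
    move=> z0 zeps; rewrite mulrC -ler_pdivlMr//.
    have -> : 2^-1 / ((p - 1) / (chi + 1)) = eps `^ (chi + 1).
      by rewrite /eps -powRrM mulVf ?gt_eqF// powRr1// ltW// divr_gt0.
    by apply: ge0_ler_powR; rewrite ?nnegrE ?(ltW chi1)// ltW.
  have [_ /(_ (2 * cF)^-1)] := SMP _ C1w wn wb _ _ ea eps0.
  have key := plaplacian_ge_phi_u M_hausdorff vol_riemannian p_gt1 chi_gt chi_le
    f_continuous f_gt0 cF0 Ff u_C1 u_solution a_gt Hphi Heps.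
  move=> /(_ key); rewrite leNgt invr_gt0 => /negP; apply; exact: mulr_gt0.
split=> //; set us := sup _; rewrite leNgt; apply/negP => fus.
(* By continuity, half of [f us] bounds [f] from below on some interval []us - d, us]], hence bounds
   [f(u)] on the superlevel set. *)
pose k := f us / 2; have k0 : 0 < k by rewrite divr_gt0.
have [d d0 Hd] : exists2 d, 0 < d & forall t, us - d < t -> t <= us -> k <= f t.
  have /cvgrPdist_lt/(_ k k0)/nbhs_ballP[d /= d0 Hd] := f_continuous us.
  exists d => // t dt tus; have : ball us d t.
    by rewrite /ball/= ger0_norm ?subr_ge0// ltrBlDr addrC -ltrBlDr.
  move=> /Hd/=; rewrite ltr_distlC => /andP[+ _] => ft; apply: le_trans (ltW ft).
  by rewrite /k; lra.
have ea : us - d < sup (range u) by rewrite ltrBlDr ltrDl.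
(* The lower bound on [f(u)] depends on the level only, so the gradient bound is arbitrary; it is
   taken to be 1. *)
have [_ /(_ k)] := SMP u u_C1 u_nonconstant Hb (us - d) 1 ea ltr01.
have key : plaplacian_ge g vol p (superlevel_small_grad g u (us - d) 1) u
    (fun x => k * grad_norm g u x `^ (p - 1 - chi)).
  apply: (plaplacian_ge_comparison M_hausdorff vol_riemannian p_gt1 u_C1 ch u_solution u_C1).
    by apply: continuous_mul_grad_norm_powR => // x; exact: cst_continuous.
  move=> psi [spsi cK KOm] psi0; exists psi; split.
  - exact: spsi.
  - exact: psi0.
  - by move=> x xK; apply: contrapT => /eqP px; apply: xK; exact: subset_closure.
  move=> x xK; rewrite /weak_form lerD2r ler_wpM2r// ler_wpM2r ?powR_ge0//.
  apply: Hd; first by have [] := KOm x xK.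
  by apply: ub_le_sup => //; exists x.
by move=> /(_ key); rewrite leNgt k0.
Qed.
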